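(* Suppose choices follow the Luce choice model with true parameter $\theta^\star\in\Theta_b$ and all (fixed) comparison sets have cardinality $k\ge2$. For each $t$, let $z_t$ be drawn uniformly at random from $S_t\setminus\{y_t\}$, independently across $t$, and let $\widehat\theta_1\in\arg\max_{\theta\in\Theta_b}\ell_1(\theta)$. If $\lambda_2(L_M)\ge 8k(k-1)e^{2b}\,n\log(n)/m$, then with probability at least $1-3/n$, $$\mathrm{MSE}(\widehat\theta_1,\theta^\star)\le D^2\frac{n(\log n+2)}{\lambda_2(L_M)^2}\frac1m,\qquad D=4k(k-1)e^{2b}.$$
   Context: Items $N=\{1,\dots,n\}$; observations $(S_t,y_t)$, $t=1,\dots,m$. Luce choice model: choices conditionally independent with $\Pr[y_t=i\mid S_t]=e^{\theta^\star_i}/\sum_{v\in S_t}e^{\theta^\star_v}$. Pseudo log-likelihood $\ell_1(\theta)=\sum_{t=1}^m\log\frac{e^{\theta_{y_t}}}{e^{\theta_{y_t}}+e^{\theta_{z_t}}}$. $\Theta_b=\{\theta\in[-b,b]^n:\sum\theta_i=0\}$; $\mathrm{MSE}=\frac1n\|\widehat\theta-\theta^\star\|_2^2$. $M$ has zero diagonal and off-diagonal entries $\frac nm\#\{t:\{i,j\}\subseteq S_t\}$; $L_A=\mathrm{diag}(A\mathbf 1)-A$; $\lambda_2$ is the second smallest eigenvalue. *)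

(* Defs.v *)
From Stdlib Require Import Reals Lra List ClassicalEpsilon.
Import ListNotations.
Open Scope R_scope.

(* Items are 0..n-1; observations are t = 0..m-1. *)

Definition sumL {A : Type} (l : list A) (f : A -> R) : R :=
  fold_right (fun a acc => f a + acc) 0 l.

Definition prodL {A : Type} (l : list A) (f : A -> R) : R :=
  fold_right (fun a acc => f a * acc) 1 l.

Definition indic (P : Prop) : R :=
  if excluded_middle_informative P then 1 else 0.

Definition in_Theta (n : nat) (b : R) (theta : nat -> R) : Prop :=
  (forall i, (i < n)%nat -> - b <= theta i <= b) /\
  sumL (seq 0 n) theta = 0.

Definition mse (n : nat) (th th' : nat -> R) : R :=
  / INR n * sumL (seq 0 n) (fun i => (th i - th' i) ^ 2).

(* An outcome is the list of pairs (y_t, z_t), t = 0..m-1. *)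
Definition outcome := list (nat * nat).

Definition ell1 (m : nat) (o : outcome) (theta : nat -> R) : R :=
  sumL (seq 0 m) (fun t =>
    let p := nth t o (0%nat, 0%nat) in
    ln (exp (theta (fst p)) / (exp (theta (fst p)) + exp (theta (snd p))))).

Definition is_argmax (n : nat) (b : R) (f : (nat -> R) -> R) (th : nat -> R) : Prop :=
  in_Theta n b th /\ forall th', in_Theta n b th' -> f th' <= f th.

Definition pairs (l : list nat) : list (nat * nat) :=
  flat_map (fun i => map (fun j => (i, j)) (filter (fun j => negb (Nat.eqb j i)) l)) l.

Fixpoint outs (Sc : nat -> list nat) (t0 cnt : nat) : list outcome :=
  match cnt with
  | O => cons nil nil
  | Datatypes.S c => flat_map (fun p => map (cons p) (outs Sc (Datatypes.S t0) c)) (pairs (Sc t0))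
  end.

Definition luce (theta : nat -> R) (S : list nat) (i : nat) : R :=
  exp (theta i) / sumL S (fun v => exp (theta v)).

(* probability of the outcome: y_t ~ Luce(theta_star), z_t uniform on S_t \ {y_t},
   all independent across t. *)
Definition weight (m k : nat) (Sc : nat -> list nat) (theta : nat -> R) (o : outcome) : R :=
  prodL (seq 0 m) (fun t =>
    let p := nth t o (0%nat, 0%nat) in
    luce theta (Sc t) (fst p) * / INR (k - 1)).

Definition prob (m k : nat) (Sc : nat -> list nat) (theta : nat -> R) (E : outcome -> Prop) : R :=
  sumL (outs Sc 0 m) (fun o => weight m k Sc theta o * indic (E o)).

Definition memb (i : nat) (l : list nat) : bool := existsb (Nat.eqb i) l.

Definition Mmat (n m : nat) (Sc : nat -> list nat) (i j : nat) : R :=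
  if Nat.eqb i j then 0
  else INR n / INR m *
       INR (length (filter (fun t => andb (memb i (Sc t)) (memb j (Sc t))) (seq 0 m))).

Definition laplacian (n : nat) (A : nat -> nat -> R) (i j : nat) : R :=
  (if Nat.eqb i j then sumL (seq 0 n) (fun c => A i c) else 0) - A i j.

(* lam is the second smallest eigenvalue (with multiplicity) of the
   symmetric n x n matrix A: eigenvalues listed in nondecreasing order
   mu_0 <= ... <= mu_{n-1} along an orthonormal eigenbasis (columns of V). *)
Definition is_lambda2 (n : nat) (A : nat -> nat -> R) (lam : R) : Prop :=
  exists (mu : nat -> R) (V : nat -> nat -> R),
    (forall i j, (i < n)%nat -> (j < n)%nat ->
       sumL (seq 0 n) (fun r => V r i * V r j) = if Nat.eqb i j then 1 else 0) /\
    (forall i r, (i < n)%nat -> (r < n)%nat ->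
       sumL (seq 0 n) (fun c => A r c * V c i) = mu i * V r i) /\
    (forall i j, (i <= j)%nat -> (j < n)%nat -> mu i <= mu j) /\
    lam = mu 1%nat.

(* Main.v *)
From mathcomp Require all_boot all_order all_algebra.
From mathcomp Require lra ring zify Rstruct.
From Coquelicot Require Coquelicot.
From Stdlib Require Reals Lra Lia Psatz ZArith Classical ClassicalEpsilon.
Require Import Defs.

(** Let [Delta] be the error of the estimator, [g] the gradient of the pseudo
    log-likelihood at [thstar] and [H] the expectation of the Hessian (with the opposite
    sign) at [thstar]; since the pairwise model is correctly specified, [H] is also the
    covariance of [g].  On a path that stays in [[-2b, 2b]] the logistic loss exceeds its
    tangent by at least its initial curvature times [d^2 / (2 + 2b)], so optimality of the
    estimator gives [Delta^T Hhat Delta <= 2 (1 + b) <g, Delta>] with [Hhat] the empirical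
    Hessian at [thstar].  In the norm of [H] this yields the error bound as soon as
    [|g|^2 <= 2 n] and [Hhat >= s H] for a suitable [s].

    The first event has probability about [1 - 2/n] by Chebyshev, because [|g|^2] has mean
    [n - 1] and variance close to [2 (n - 1)] in this norm.  For the second one the trace
    moments of [W = H^(-1/2) Hhat H^(-1/2) - 1] satisfy a recursion, obtained by resampling
    one observation at a time together with a mean-value inequality for traces of powers.
    The event is trivially true unless its right-hand side is below [4 b^2], the squared
    diameter of the box, and this gives all the sample size that the two estimates need. *)

Module Logistic.
Import Reals Lra Lia Psatz ZArith Coquelicot.
Local Open Scope R_scope.

(** * Logistic loss *)

(** The curvature is taken at [thstar] because this makes the Hessian a sum of independent matrices,
    free of the estimator; a curvature bound uniform over the box would cost a factor exponential in
    [b], where self-concordance costs only [2 + 2b]. With [K = 2 + 2b], [T = 2n] and [h] a lower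
    bound for the eigenvalues of [H], the two events give [|Delta|^2 <= K^2 T / (s^2 h)]. The value
    of [s] is then forced: it makes this equal to the claimed bound, so
    [s^2 = (1+b)^2 e^(-2b) x / (ln n + 2)] with [x = lambda_2 / (k(k-1))]. It stays away from 1,
    because [1 + b <= e^b] and the trace of the Laplacian bounds [x] by [n/(n-1)]; the second event
    thus concerns a relative deviation of constant size. The obstacle is the failure probability
    [3/n], required for all [n >= 4] with little room: for large [n] Chebyshev takes about [2.25/n]
    and leaves [0.75/n] to the trace moment, and at [n = 4] the numerical bounds meet [3/4] exactly.
    This is why constants are tracked through the moment recursion and the order of the moment is
    optimised. *)

Definition lgs (y : R) : R := ln (1 + exp (- y)).
Definition sgm (y : R) : R := / (1 + exp (- y)).
Definition lcurv (y : R) : R := sgm y * (1 - sgm y).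

Lemma lgs_derive y : is_derive lgs y (sgm y - 1).
Proof.
  unfold lgs, sgm. pose proof (exp_pos (- y)).
  auto_derive; [lra | field; lra].
Qed.

Lemma sgm_derive y : is_derive sgm y (lcurv y).
Proof.
  unfold lcurv, sgm. pose proof (exp_pos (- y)).
  auto_derive; [lra | field; lra].
Qed.

Lemma lcurvE y : lcurv y = / (2 + exp y + exp (- y)).
Proof.
  unfold lcurv, sgm. rewrite exp_Ropp. pose proof (exp_pos y) as E. field.
  split; [lra|]. split; [nra|]. nra.
Qed.

Lemma sgm_bounds y : 0 < sgm y < 1.
Proof.
  unfold sgm. pose proof (exp_pos (- y)). split.
  - apply Rinv_0_lt_compat; lra.
  - rewrite <- Rinv_1 at 2. apply Rinv_lt_contravar; lra.
Qed.

Lemma sgm_opp y : sgm (- y) = 1 - sgm y.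
Proof.
  unfold sgm. rewrite Ropp_involutive, exp_Ropp. pose proof (exp_pos y). field; lra.
Qed.

Lemma lgs_opp y : lgs (- y) = lgs y + y.
Proof.
  unfold lgs. rewrite Ropp_involutive.
  replace (1 + exp y) with ((1 + exp (- y)) * exp y).
  - pose proof (exp_pos y); pose proof (exp_pos (- y)).
    rewrite ln_mult, ln_exp; lra.
  - rewrite Rmult_plus_distr_r, <- exp_plus, Rplus_opp_l, exp_0. lra.
Qed.

Lemma lcurv_opp y : lcurv (- y) = lcurv y.
Proof. unfold lcurv. rewrite sgm_opp. ring. Qed.

Lemma lcurv_pos y : 0 < lcurv y.
Proof. pose proof (sgm_bounds y). unfold lcurv. nra. Qed.

Lemma nonneg_of_deriv (f f' : R -> R) (d : R) : 0 <= d -> 0 <= f 0 ->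
  (forall s, 0 <= s <= d -> is_derive f s (f' s)) ->
  (forall s, 0 <= s <= d -> 0 <= f' s) -> 0 <= f d.
Proof.
  intros Hd H0 Hf Hf'. destruct (Req_dec d 0) as [->|Hn]; [exact H0|].
  destruct (MVT_cor2 f f' 0 d) as [c [Hc1 Hc2]].
  - lra.
  - intros c Hc. apply is_derive_Reals, Hf, Hc.
  - pose proof (Hf' c ltac:(lra)). nra.
Qed.

(** The Bregman divergence of the logistic loss, as [lgs' = sgm - 1]. *)
Definition lbreg (c d : R) : R := lgs (c + d) - lgs c + (1 - sgm c) * d.

(** Both sides vanish to first order at 0, so comparing second derivatives and integrating twice
    suffices. *)
Lemma lbreg_ge (c d : R) (q q' q'' : R -> R) : 0 <= d -> q 0 = 0 -> q' 0 = 0 ->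
  (forall s, is_derive q s (q' s)) -> (forall s, is_derive q' s (q'' s)) ->
  (forall s, 0 <= s <= d -> q'' s <= lcurv (c + s)) -> q d <= lbreg c d.
Proof.
  intros Hd q0 q'0 Dq Dq' Hq.
  assert (D1 : forall s, is_derive (fun s => sgm (c + s) - sgm c - q' s) s (lcurv (c + s) - q'' s)).
  { intros s. apply (is_derive_minus (fun s => sgm (c + s) - sgm c) q'); [|apply Dq'].
    replace (lcurv (c + s)) with (minus (scal 1 (lcurv (c + s))) 0)
      by (unfold minus, plus, opp, scal; simpl; unfold mult; simpl; ring).
    apply (is_derive_minus (fun s => sgm (c + s)) (fun _ => sgm c)).
    - apply (is_derive_comp sgm (fun s => c + s)); [apply sgm_derive|].
      auto_derive; [exact I | ring].
    - apply (@is_derive_const R_AbsRing R_NormedModule). }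
  assert (P1 : forall s, 0 <= s <= d -> 0 <= sgm (c + s) - sgm c - q' s).
  { intros s Hs. apply (nonneg_of_deriv (fun s => sgm (c + s) - sgm c - q' s)
      (fun s => lcurv (c + s) - q'' s)).
    - lra.
    - rewrite Rplus_0_r, q'0. lra.
    - intros r Hr. apply D1.
    - intros r Hr. pose proof (Hq r ltac:(lra)). lra. }
  assert (D2 : forall s, is_derive (fun s => lbreg c s - q s) s (sgm (c + s) - sgm c - q' s)).
  { intros s. apply (is_derive_minus (lbreg c) q); [|apply Dq].
    unfold lbreg.
    replace (sgm (c + s) - sgm c) with
      (plus (minus (scal 1 (sgm (c + s) - 1)) 0) (1 - sgm c))
      by (unfold minus, plus, opp, scal; simpl; unfold mult; simpl; ring).
    apply (is_derive_plus (fun s => lgs (c + s) - lgs c) (fun s => (1 - sgm c) * s)).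
    - apply (is_derive_minus (fun s => lgs (c + s)) (fun _ => lgs c)).
      + apply (is_derive_comp lgs (fun s => c + s)); [apply lgs_derive|].
        auto_derive; [exact I | ring].
      + apply (@is_derive_const R_AbsRing R_NormedModule).
    - auto_derive; [exact I | ring]. }
  pose proof (nonneg_of_deriv (fun s => lbreg c s - q s)
    (fun s => sgm (c + s) - sgm c - q' s) d Hd) as N. cbv beta in N.
  enough (0 <= lbreg c d - q d) by lra. apply N.
  - unfold lbreg. rewrite Rplus_0_r, q0. lra.
  - intros s _. apply D2.
  - exact P1.
Qed.

(** Equivalent to the Pade bound [(2 - s) / (2 + s) <= e^(-s)]. *)
Lemma exp_pade (s : R) : 0 <= s -> s ^ 2 / (2 + s) <= exp (- s) + s - 1.
Proof.
  intros Hs.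
  assert (0 <= (2 + s) * exp (- s) + s - 2) as H.
  { apply (nonneg_of_deriv (fun s => (2 + s) * exp (- s) + s - 2)
      (fun s => 1 - (1 + s) * exp (- s))); [exact Hs| | |].
    - rewrite Ropp_0, exp_0. lra.
    - intros r _. auto_derive; [exact I | ring].
    - intros r Hr. pose proof (exp_ineq1_le r). pose proof (exp_pos (- r)).
      assert (exp r * exp (- r) = 1) by (rewrite <- exp_plus, Rplus_opp_r; apply exp_0).
      nra. }
  apply Rmult_le_reg_r with (2 + s); [lra|].
  replace (s ^ 2 / (2 + s) * (2 + s)) with (s ^ 2) by (field; lra). nra.
Qed.

(** Self-concordance in integrated form: the logarithm of [lcurv] has slope at least -1. *)
Lemma lcurv_decay (c s : R) : 0 <= s -> lcurv c * exp (- s) <= lcurv (c + s).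
Proof.
  intros Hs. rewrite !lcurvE.
  pose proof (exp_pos (c + s)); pose proof (exp_pos (- (c + s))).
  pose proof (exp_pos c); pose proof (exp_pos (- c)); pose proof (exp_pos s) as Es.
  rewrite (exp_Ropp s), <- Rinv_mult.
  apply Rinv_le_contravar; [lra|].
  pose proof (exp_ineq1_le s).
  assert (E1 : exp (c + s) = exp c * exp s) by apply exp_plus.
  assert (E2 : exp (- c) = exp (- (c + s)) * exp s)
    by (rewrite <- exp_plus; f_equal; ring).
  assert (exp (- (c + s)) <= exp (- c) * exp s) by (rewrite E2; nra).
  nra.
Qed.

Lemma lcurv_mono (a y : R) : - a <= y <= a -> lcurv a <= lcurv y.
Proof.
  intros Hy. rewrite !lcurvE.
  pose proof (exp_pos y); pose proof (exp_pos (- y)); pose proof (exp_pos (- a)).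
  apply Rinv_le_contravar; [lra|].
  assert (exp y <= exp a) by (destruct (Req_dec y a) as [->|]; [lra|left; apply exp_increasing; lra]).
  assert (E1 : exp y * exp (- y) = 1) by (rewrite <- exp_plus, Rplus_opp_r; apply exp_0).
  assert (E2 : exp a * exp (- a) = 1) by (rewrite <- exp_plus, Rplus_opp_r; apply exp_0).
  assert (exp (- a) <= exp y) by (destruct (Req_dec y (- a)) as [->|]; [lra|left; apply exp_increasing; lra]).
  assert (exp (- a) * exp (- y) <= 1) by nra.
  assert (0 <= (exp a - exp y) * (1 - exp (- a) * exp (- y))) by nra.
  nra.
Qed.

Lemma lbreg_exp (c d : R) : 0 <= d -> lcurv c * (exp (- d) + d - 1) <= lbreg c d.
Proof.
  intros Hd.
  apply (lbreg_ge c d (fun s => lcurv c * (exp (- s) + s - 1))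
    (fun s => lcurv c * (1 - exp (- s))) (fun s => lcurv c * exp (- s))); [exact Hd| | | | |].
  - rewrite Ropp_0, exp_0. ring.
  - rewrite Ropp_0, exp_0. ring.
  - intros s. auto_derive; [exact I | ring].
  - intros s. auto_derive; [exact I | ring].
  - intros s Hs. apply lcurv_decay; lra.
Qed.

Lemma lbreg_sq (a d : R) : 0 <= d <= 2 * a -> lcurv a * (d ^ 2 / 2) <= lbreg (- a) d.
Proof.
  intros Hd.
  apply (lbreg_ge (- a) d (fun s => lcurv a * (s ^ 2 / 2))
    (fun s => lcurv a * s) (fun s => lcurv a)); [lra| | | | |].
  - field.
  - ring.
  - intros s. auto_derive; [exact I | field].
  - intros s. auto_derive; [exact I | ring].
  - intros s Hs. apply lcurv_mono; lra.
Qed.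

(** [sgm] has derivative [lcurv], which on [[-a, a]] is smallest at the ends. *)
Lemma sgm_gap (a : R) : 0 <= a -> 2 * a * lcurv a <= sgm a - sgm (- a).
Proof.
  intros Ha. destruct (Req_dec a 0) as [->|Hn]; [rewrite Ropp_0; lra|].
  destruct (MVT_cor2 sgm lcurv (- a) a) as [c [Hc1 Hc2]].
  - lra.
  - intros c _. apply is_derive_Reals, sgm_derive.
  - rewrite Hc1. pose proof (lcurv_mono a c ltac:(lra)). nra.
Qed.

Lemma sq_div_le (w u : R) : 0 <= w <= u -> w ^ 2 / (2 + u) <= w ^ 2 / (2 + w).
Proof.
  intros H. unfold Rdiv. apply Rmult_le_compat_l; [nra|].
  apply Rinv_le_contravar; lra.
Qed.

(* A path of length more than [u] inside [[-u,u]] has to cross [0]: it first traverses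
   [[-a,a]], where the curvature is at least the initial one, and only the rest [w <= u] decays. *)
Lemma lbreg_quadratic_right (u c d : R) : - u <= c <= u -> c + d <= u -> 0 <= d ->
  lcurv c * (d ^ 2 / (2 + u)) <= lbreg c d.
Proof.
  intros Hc Hcd Hd. pose proof (lcurv_pos c) as Kp.
  destruct (Rle_or_lt 0 c) as [Hc0|Hc0].
  - eapply Rle_trans; [|apply lbreg_exp; exact Hd].
    apply Rmult_le_compat_l; [lra|].
    eapply Rle_trans; [|apply exp_pade; exact Hd].
    apply sq_div_le; lra.
  - set (a := - c). assert (Ec : c = - a) by (unfold a; ring).
    assert (Ha : 0 < a) by (unfold a; lra). rewrite Ec in *. clearbody a.
    rewrite lcurv_opp in *.
    destruct (Rle_or_lt d (2 * a)) as [Hda|Hda].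
    + eapply Rle_trans; [|apply lbreg_sq; lra].
      apply Rmult_le_compat_l; [lra|]. unfold Rdiv.
      apply Rmult_le_compat_l; [nra|]. apply Rinv_le_contravar; lra.
    + set (w := d - 2 * a). assert (Ed : d = 2 * a + w) by (unfold w; ring).
      assert (Hw : 0 < w) by (unfold w; lra). clearbody w. subst d.
      (* Divergences over consecutive pieces add up, except that the slope has meanwhile risen by
         [sgm a - sgm (- a)]. By [sgm_gap] this rise pays for the cross term in the square of
         [2 * a + w]. *)
      assert (E : lbreg (- a) (2 * a + w) =
        lbreg (- a) (2 * a) + lbreg a w + (sgm a - sgm (- a)) * w).
      { unfold lbreg. replace (- a + (2 * a + w)) with (a + w) by ring.
        replace (- a + 2 * a) with a by ring. ring. }
      rewrite E.
      pose proof (lbreg_sq a (2 * a) ltac:(lra)) as L1.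
      pose proof (lbreg_exp a w ltac:(lra)) as L2.
      pose proof (exp_pade w ltac:(lra)) as L3.
      pose proof (sgm_gap a ltac:(lra)) as L4.
      pose proof (sq_div_le w u ltac:(lra)) as L5.
      assert (L6 : lcurv a * (w ^ 2 / (2 + u)) <= lbreg a w) by nra.
      assert (L7 : (2 * a * lcurv a) * w <= (sgm a - sgm (- a)) * w) by nra.
      assert (L8 : (4 * a ^ 2 + 4 * a * w) / (2 + u) <= 2 * a ^ 2 + 2 * a * w).
      { apply Rmult_le_reg_r with (2 + u); [lra|].
        replace ((4 * a ^ 2 + 4 * a * w) / (2 + u) * (2 + u)) with (4 * a ^ 2 + 4 * a * w)
          by (field; lra).
        assert (0 <= (a ^ 2 + a * w) * u) by (apply Rmult_le_pos; nra). nra. }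
      replace ((2 * a + w) ^ 2 / (2 + u)) with
        ((4 * a ^ 2 + 4 * a * w) / (2 + u) + w ^ 2 / (2 + u)) by (field; lra).
      apply (Rmult_le_compat_l (lcurv a)) in L8; [|lra].
      replace ((2 * a) ^ 2 / 2) with (2 * a ^ 2) in L1 by field.
      lra.
Qed.

Lemma lbreg_quadratic (u c d : R) : - u <= c <= u -> - u <= c + d <= u ->
  lcurv c * (d ^ 2 / (2 + u)) <= lbreg c d.
Proof.
  intros Hc Hcd. destruct (Rle_or_lt 0 d) as [Hd|Hd].
  - apply lbreg_quadratic_right; lra.
  - assert (E : lbreg c d = lbreg (- c) (- d)).
    { unfold lbreg. rewrite sgm_opp, lgs_opp.
      replace (- c + - d) with (- (c + d)) by ring. rewrite lgs_opp. ring. }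
    rewrite E, <- (lcurv_opp c). replace (d ^ 2) with ((- d) ^ 2) by ring.
    apply lbreg_quadratic_right; lra.
Qed.

(** * Rational bounds for exp and ln *)

Lemma exp_ge_quadratic (x : R) : 0 <= x -> 1 + x + x ^ 2 / 2 <= exp x.
Proof.
  intros Hx.
  enough (0 <= exp x - (1 + x + x ^ 2 / 2)) by lra.
  apply (nonneg_of_deriv (fun s => exp s - (1 + s + s ^ 2 / 2)) (fun s => exp s - (1 + s))).
  - exact Hx.
  - rewrite exp_0. lra.
  - intros s _. auto_derive; [exact I | field].
  - intros s _. pose proof (exp_ineq1_le s). lra.
Qed.

Lemma exp_le_pade (s : R) : 0 <= s < 2 -> exp s <= (2 + s) / (2 - s).
Proof.
  intros Hs. pose proof (exp_pade s ltac:(lra)) as H.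
  pose proof (exp_pos s); pose proof (exp_pos (- s)).
  assert (E : exp s * exp (- s) = 1) by (rewrite <- exp_plus, Rplus_opp_r; apply exp_0).
  apply (Rmult_le_compat_r (2 + s)) in H; [|lra].
  replace (s ^ 2 / (2 + s) * (2 + s)) with (s ^ 2) in H by (field; repeat split; lra).
  apply Rmult_le_reg_r with (2 - s); [lra|].
  replace ((2 + s) / (2 - s) * (2 - s)) with (2 + s) by (field; repeat split; lra).
  assert (2 - s <= (2 + s) * exp (- s)) by nra. nra.
Qed.

Lemma exp_mult_INR (x : R) (k : nat) : exp (INR k * x) = exp x ^ k.
Proof.
  induction k as [|k IH].
  - simpl. rewrite Rmult_0_l. apply exp_0.
  - rewrite S_INR. simpl. rewrite <- IH, <- exp_plus. f_equal. ring.
Qed.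

(** The Pade bound at [c / 4], raised to the fourth power, reduces a numerical lower bound for [ln]
    to a rational inequality. *)
Lemma ln_ge_of_pade4 (c a : R) : 0 <= c < 8 -> ((8 + c) / (8 - c)) ^ 4 <= a -> c <= ln a.
Proof.
  intros Hc Ha.
  assert (E : exp c <= a).
  { eapply Rle_trans; [|exact Ha].
    replace c with (INR 4 * (c / 4)) at 1 by (simpl; field).
    rewrite exp_mult_INR. apply pow_incr. split; [left; apply exp_pos|].
    eapply Rle_trans; [apply exp_le_pade; lra|].
    right. field. lra. }
  rewrite <- (ln_exp c). pose proof (exp_pos c).
  destruct E as [E|E]; [left; apply ln_increasing; lra | rewrite E; lra].
Qed.

(** * Odd factorials and the optimal order of the moment *)

(** This is [(2p-1)!!]: the recursion for the trace moments contributes the factor [2j + 1] at its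
    step [j]. *)
Fixpoint odd_fact (p : nat) : R :=
  match p with O => 1 | S q => odd_fact q * (2 * INR q + 1) end.

Lemma odd_fact_pos p : 0 < odd_fact p.
Proof. induction p; simpl; [lra|]. pose proof (pos_INR p). nra. Qed.

(** At the argument [2 / (2p+1)] the Pade quotient is exactly [(p+1) / p], so the power is at least
    [e^(1 + 1/(2p+1))]. *)
Lemma pow_succ_ratio_ge (p : R) (k : nat) : 0 < p -> INR k = p ->
  exp 1 * ((2 * p + 2) / (2 * p + 1)) <= ((p + 1) / p) ^ (S k).
Proof.
  intros Hp Hk.
  assert (L : exp (2 / (2 * p + 1)) <= (p + 1) / p).
  { assert (0 < 2 / (2 * p + 1)) by (apply Rdiv_lt_0_compat; lra).
    assert (2 / (2 * p + 1) < 2).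
    { apply Rmult_lt_reg_r with (2 * p + 1); [lra|].
      replace (2 / (2 * p + 1) * (2 * p + 1)) with 2 by (field; repeat split; lra). lra. }
    eapply Rle_trans; [apply exp_le_pade; lra|].
    right. field. lra. }
  apply Rle_trans with (exp (2 / (2 * p + 1)) ^ (S k)).
  - rewrite <- exp_mult_INR, S_INR, Hk.
    replace ((p + 1) * (2 / (2 * p + 1))) with (1 + 1 / (2 * p + 1)) by (field; repeat split; lra).
    rewrite exp_plus. apply Rmult_le_compat_l; [left; apply exp_pos|].
    replace ((2 * p + 2) / (2 * p + 1)) with (1 + 1 / (2 * p + 1)) by (field; repeat split; lra).
    apply exp_ineq1_le.
  - apply pow_incr. split; [left; apply exp_pos | exact L].
Qed.

(** The quotient of [(2p-1)!!] by [(2p/e)^p] increases with [p], so an induction with a constant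
    factor would not close. The factor [e p / (p+1)], exact at [p = 1], grows fast enough to close
    it. *)
Lemma odd_fact_stirling (k : nat) :
  odd_fact (S k) * (INR (S k) + 1) <=
  exp 1 * INR (S k) * (2 * INR (S k) / exp 1) ^ (S k).
Proof.
  pose proof (exp_pos 1) as E.
  induction k as [|k IH].
  - simpl. right. field. lra.
  - set (p := INR (S k)) in *.
    assert (Hp : 0 < p) by (apply lt_0_INR; lia).
    pose proof (pow_succ_ratio_ge p (S k) Hp eq_refl) as Q.
    assert (EP : INR (S (S k)) = p + 1) by (unfold p; rewrite (S_INR (S k)); reflexivity).
    rewrite EP. change (odd_fact (S (S k))) with (odd_fact (S k) * (2 * p + 1)).
    set (o := odd_fact (S k)) in *. assert (Ho : 0 < o) by apply odd_fact_pos.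
    set (X := (2 * p / exp 1) ^ S k) in *.
    assert (HX : 0 < X) by (apply pow_lt, Rdiv_lt_0_compat; lra).
    set (Z := ((p + 1) / p) ^ S (S k)) in *.
    assert (RHS : exp 1 * (p + 1) * (2 * (p + 1) / exp 1) ^ S (S k) = 2 * p * (p + 1) * X * Z).
    { unfold X, Z.
      replace (2 * (p + 1) / exp 1) with ((2 * p / exp 1) * ((p + 1) / p)) by (field; repeat split; lra).
      rewrite Rpow_mult_distr. simpl. field. lra. }
    rewrite RHS.
    apply Rle_trans with (exp 1 * p * X / (p + 1) * ((2 * p + 1) * (p + 2))).
    { replace (o * (2 * p + 1) * (p + 1 + 1)) with (o * (p + 1) / (p + 1) * ((2 * p + 1) * (p + 2))) by (field; repeat split; lra).
      apply Rmult_le_compat_r; [nra|]. apply Rmult_le_compat_r; [|exact IH].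
      left; apply Rinv_0_lt_compat; lra. }
    apply Rle_trans with (2 * p * (p + 1) * X * (exp 1 * ((2 * p + 2) / (2 * p + 1)))).
    2:{ apply Rmult_le_compat_l; [|exact Q]. apply Rmult_le_pos; [nra|lra]. }
    assert (F : (2 * p + 1) * (p + 2) / (p + 1) <= 2 * (p + 1) * ((2 * p + 2) / (2 * p + 1))).
    { apply Rmult_le_reg_r with ((p + 1) * (2 * p + 1)); [nra|].
      replace ((2 * p + 1) * (p + 2) / (p + 1) * ((p + 1) * (2 * p + 1)))
        with ((2 * p + 1) ^ 2 * (p + 2)) by (field; repeat split; lra).
      replace (2 * (p + 1) * ((2 * p + 2) / (2 * p + 1)) * ((p + 1) * (2 * p + 1)))
        with (4 * (p + 1) ^ 3) by (field; repeat split; lra).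
      nra. }
    replace (exp 1 * p * X / (p + 1) * ((2 * p + 1) * (p + 2)))
      with (exp 1 * p * X * ((2 * p + 1) * (p + 2) / (p + 1))) by (field; repeat split; lra).
    replace (2 * p * (p + 1) * X * (exp 1 * ((2 * p + 2) / (2 * p + 1))))
      with (exp 1 * p * X * (2 * (p + 1) * ((2 * p + 2) / (2 * p + 1)))) by (field; repeat split; lra).
    apply Rmult_le_compat_l; [|exact F]. assert (0 < exp 1 * p) by nra. nra.
Qed.

(** Markov's inequality leads to this product, with [Y = 2h(1-s)^2]. By the Stirling bound it is at
    most [e (6p / (eY))^p] at order [p], hence at most [e^(1-p)] as long as [6p <= Y]. The order is
    read off from the lower bound [A] of [Y], which depends on [n] alone. *)
Lemma odd_fact_tail (A Y : R) : 12 <= A -> A <= Y -> exists k : nat,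
  6 * INR (S k) <= A /\ (3 / Y) ^ (S k) * odd_fact (S k) <= exp (2 - A / 6).
Proof.
  intros HA HY. pose proof (exp_pos 1) as E.
  destruct (archimed (A / 6)) as [U1 U2].
  assert (Hz : (2 <= up (A / 6))%Z).
  { apply Z.lt_le_incl. apply lt_IZR. lra. }
  (* [up] exceeds its argument strictly and by at most 1, so [S k] is the floor of [A / 6]; it is at
     least 2 since [12 <= A]. *)
  set (k := Z.to_nat (up (A / 6) - 2)).
  assert (Hk : INR (S k) = IZR (up (A / 6)) - 1).
  { rewrite S_INR. unfold k. rewrite INR_IZR_INZ, Z2Nat.id by lia.
    rewrite minus_IZR. lra. }
  exists k. pose proof (odd_fact_stirling k) as St.
  set (p := INR (S k)) in *. split; [lra|].
  assert (Hp : 0 < p) by lra.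
  set (X := (2 * p / exp 1) ^ S k) in *.
  assert (HX : 0 < X) by (apply pow_lt, Rdiv_lt_0_compat; lra).
  assert (O : odd_fact (S k) <= exp 1 * X).
  { apply Rmult_le_reg_r with (p + 1); [lra|]. pose proof (odd_fact_pos (S k)).
    assert (0 < exp 1 * X) by nra. nra. }
  assert (P : 0 <= (3 / Y) ^ S k) by (apply pow_le; left; apply Rdiv_lt_0_compat; lra).
  apply Rle_trans with ((3 / Y) ^ S k * (exp 1 * X)); [apply Rmult_le_compat_l; assumption|].
  replace ((3 / Y) ^ S k * (exp 1 * X)) with (exp 1 * (3 / Y * (2 * p / exp 1)) ^ S k)
    by (unfold X; rewrite Rpow_mult_distr; ring).
  apply Rle_trans with (exp 1 * (/ exp 1) ^ S k).
  - apply Rmult_le_compat_l; [lra|]. apply pow_incr. split.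
    + apply Rmult_le_pos; left; apply Rdiv_lt_0_compat; lra.
    + replace (3 / Y * (2 * p / exp 1)) with (6 * p / Y * / exp 1) by (field; repeat split; lra).
      rewrite <- (Rmult_1_l (/ exp 1)) at 2. apply Rmult_le_compat_r.
      * left; apply Rinv_0_lt_compat; lra.
      * apply Rmult_le_reg_r with Y; [lra|].
        replace (6 * p / Y * Y) with (6 * p) by (field; repeat split; lra). lra.
  - rewrite <- exp_Ropp, <- exp_mult_INR, <- exp_plus.
    fold p. destruct (Req_dec (1 + p * - (1)) (2 - A / 6)) as [->|Hn]; [lra|].
    left. apply exp_increasing. lra.
Qed.

(** * Numerical choice of the parameters *)

Lemma exp_ge_271 (b : R) : 0 <= b -> 2.71 * b <= exp b.
Proof.
  intros Hb.
  assert (H : 2.71 <= exp 1).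
  { replace 1 with (INR 8 * (1 / 8)) by (simpl; field). rewrite exp_mult_INR.
    apply Rle_trans with ((1 + 1 / 8 + (1 / 8) ^ 2 / 2) ^ 8); [lra|].
    apply pow_incr. split; [lra|]. apply exp_ge_quadratic. lra. }
  pose proof (exp_ineq1_le (b - 1)) as T.
  replace b with (1 + (b - 1)) at 2 by ring. rewrite exp_plus.
  pose proof (exp_pos (b - 1)). nra.
Qed.

(* Tangent line of exp at 2/3 for small b, and exp b >= e b for the rest. *)
Lemma exp_tangent_bound (w b : R) : 1.55 <= w -> 0 <= b ->
  1 + (2.71 * w - 1.2) * b <= w * exp b.
Proof.
  intros Hw Hb. destruct (Rle_or_lt (1 / 1.2) b) as [H|H].
  - pose proof (exp_ge_271 b Hb). nra.
  - assert (E : 1.94 <= exp (2 / 3)).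
    { replace (2 / 3) with (INR 4 * (1 / 6)) by (simpl; field). rewrite exp_mult_INR.
      apply Rle_trans with ((1 + 1 / 6 + (1 / 6) ^ 2 / 2) ^ 4); [lra|].
      apply pow_incr. split; [lra|]. apply exp_ge_quadratic. lra. }
    pose proof (exp_ineq1_le (b - 2 / 3)) as T.
    assert (T2 : 1.94 * (1 / 3 + b) <= exp b).
    { replace b with (2 / 3 + (b - 2 / 3)) at 2 by ring. rewrite exp_plus. nra. }
    assert (0 <= 1.94 * (1 / 3 + b) - 2.71 * b) by lra.
    nra.
Qed.

(* Lower bound for [2 h (1 - s)^2] in [tail_parameters], that is for [(1 - s)^2] divided by
   the maximal size of one summand: the worst [b] of [exp_tangent_bound]. *)
Definition tailA (n : nat) : R :=
  4 * (2.71 * sqrt ((ln (INR n) + 2) * (INR n - 1) / INR n) - 2.2) ^ 2.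

Lemma exp_neg_le (x c : R) : 0 < c -> 0 <= x -> / c <= 1 + x + x ^ 2 / 2 -> exp (- x) <= c.
Proof.
  intros Hc Hx H. rewrite exp_Ropp, <- (Rinv_inv c).
  apply Rinv_le_contravar; [apply Rinv_0_lt_compat; lra|].
  pose proof (exp_ge_quadratic x Hx). lra.
Qed.

Lemma tail_root_ge (n : nat) (c l : R) : (0 < n)%nat -> l <= ln (INR n) -> 0 <= c ->
  1 <= INR n -> c ^ 2 * INR n <= (l + 2) * (INR n - 1) ->
  c <= sqrt ((ln (INR n) + 2) * (INR n - 1) / INR n).
Proof.
  intros Hn Hl Hc H1 H. rewrite <- (sqrt_pow2 c Hc). apply sqrt_le_1_alt.
  apply Rmult_le_reg_r with (INR n); [lra|].
  replace ((ln (INR n) + 2) * (INR n - 1) / INR n * INR n)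
    with ((ln (INR n) + 2) * (INR n - 1)) by (field; repeat split; lra). nra.
Qed.

(** The worst case is [n = 4], where the root is about 1.59. *)
Lemma tail_root_lower (n : nat) : (4 <= n)%nat ->
  1.58 <= sqrt ((ln (INR n) + 2) * (INR n - 1) / INR n).
Proof.
  intros Hn. assert (H4 : 4 <= INR n) by (apply (le_INR 4) in Hn; simpl in Hn; lra).
  apply (tail_root_ge n _ 1.335); [lia| |lra|lra|nra].
  apply ln_ge_of_pade4; [lra|].
  apply Rle_trans with 4; [|exact H4]. lra.
Qed.

(** The first summand is the Chebyshev estimate, the second the moment estimate at the optimised
    order. From [n = 8] on they stay below [2.25/n] and [0.75/n]; the four smaller values are
    settled one by one. *)
Lemma tail_sum_le (n : nat) : (4 <= n)%nat ->
  2.25 * (INR n - 1) / (INR n + 1) ^ 2 + (INR n - 1) / 3 * exp (2 - tailA n / 6) <= 3 / INR n.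
Proof.
  intros Hn. pose proof (tail_root_lower n Hn) as R0. unfold tailA.
  pose proof (fun c l => tail_root_ge n c l ltac:(lia)) as RG.
  set (v := sqrt ((ln (INR n) + 2) * (INR n - 1) / INR n)) in *.
  set (a := 4 * (2.71 * v - 2.2) ^ 2 / 6).
  assert (Hcase : n = 4%nat \/ n = 5%nat \/ n = 6%nat \/ n = 7%nat \/ (8 <= n)%nat) by lia.
  destruct Hcase as [->|[->|[->|[->|H8]]]].
  (* No slack remains: Chebyshev uses [2.25 * 3 / 25 = 0.27], and [0.27 + 0.48 = 3/4]. *)
  - replace (INR 4) with 4 in * by (simpl; ring).
    assert (A : 2.88 <= a) by (unfold a; nra).
    assert (X : exp (2 - a) <= 0.48).
    { replace (2 - a) with (- (a - 2)) by ring. apply exp_neg_le; [lra|lra|]. nra. }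
    lra.
  - replace (INR 5) with 5 in * by (simpl; ring).
    assert (1.68 <= v) by (apply (RG _ 1.55); try lra; apply ln_ge_of_pade4; lra).
    assert (A : 3.68 <= a) by (unfold a; nra).
    assert (X : exp (2 - a) <= 0.25).
    { replace (2 - a) with (- (a - 2)) by ring. apply exp_neg_le; [lra|lra|]. nra. }
    lra.
  - replace (INR 6) with 6 in * by (simpl; ring).
    assert (1.74 <= v) by (apply (RG _ 1.65); try lra; apply ln_ge_of_pade4; lra).
    assert (A : 4.2 <= a) by (unfold a; nra).
    assert (X : exp (2 - a) <= 0.16).
    { replace (2 - a) with (- (a - 2)) by ring.
      (* The quadratic bound for exp is too weak at [a - 2 = 2.2], so it is applied to half the
         exponent and squared. *)
      replace (- (a - 2)) with (INR 2 * (- ((a - 2) / 2))) by (simpl; field).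
      rewrite exp_mult_INR. assert (exp (- ((a - 2) / 2)) <= 0.4).
      { apply exp_neg_le; [lra|lra|]. nra. }
      pose proof (exp_pos (- ((a - 2) / 2))). simpl. nra. }
    lra.
  - replace (INR 7) with 7 in * by (simpl; ring).
    assert (1.78 <= v) by (apply (RG _ 1.7); try lra; apply ln_ge_of_pade4; lra).
    assert (A : 4.58 <= a) by (unfold a; nra).
    assert (X : exp (2 - a) <= 0.1075).
    { replace (2 - a) with (- (a - 2)) by ring.
      replace (- (a - 2)) with (INR 2 * (- ((a - 2) / 2))) by (simpl; field).
      rewrite exp_mult_INR. assert (exp (- ((a - 2) / 2)) <= 0.3275).
      { apply exp_neg_le; [lra|lra|]. nra. }
      pose proof (exp_pos (- ((a - 2) / 2))). simpl. nra. }
    lra.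
  - assert (N8 : 8 <= INR n) by (apply (le_INR 8) in H8; simpl in H8; lra).
    set (N := INR n) in *.
    assert (L2 : 2 <= ln N).
    { apply ln_ge_of_pade4; [lra|]. apply Rle_trans with 8; [lra|exact N8]. }
    set (y := sqrt (ln N + 2)).
    assert (Hy2 : y ^ 2 = ln N + 2) by (apply pow2_sqrt; lra).
    assert (Hy : 2 <= y).
    { pose proof (sqrt_pos (ln N + 2)) as Y0. fold y in Y0. nra. }
    assert (Hv : 0.935 * y <= v).
    { apply (RG _ (ln N)); [lra|nra|lra|].
      replace ((0.935 * y) ^ 2) with (0.935 ^ 2 * y ^ 2) by ring. rewrite Hy2. nra. }
    assert (A : 2 * ln N + 1.19 <= a).
    { assert (0 <= 2.71 * (0.935 * y) - 2.2) by lra.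
      assert ((2.71 * (0.935 * y) - 2.2) ^ 2 <= (2.71 * v - 2.2) ^ 2) by nra.
      unfold a. replace (ln N) with (y ^ 2 - 2) by lra. nra. }
    (* Together with the factor [(N - 1) / 3] this is the share [0.75 / N]; the constant is
       [e^(2 - 1.19) <= 2.25]. *)
    assert (X : exp (2 - a) <= 2.25 / N ^ 2).
    { apply Rle_trans with (exp (0.81 + - (ln N + ln N))).
      - destruct (Req_dec (2 - a) (0.81 + - (ln N + ln N))) as [->|]; [lra|].
        left. apply exp_increasing. lra.
      - rewrite exp_plus, exp_Ropp, exp_plus, exp_ln by lra.
        replace (N * N) with (N ^ 2) by ring. unfold Rdiv. apply Rmult_le_compat_r.
        + left. apply Rinv_0_lt_compat. nra.
        + replace 0.81 with (INR 8 * 0.10125) by (simpl; lra). rewrite exp_mult_INR.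
          apply Rle_trans with (((2 + 0.10125) / (2 - 0.10125)) ^ 8); [|lra].
          apply pow_incr. split; [left; apply exp_pos|]. apply exp_le_pade. lra. }
    apply Rle_trans with (9 / 4 * (N - 1) / (N + 1) ^ 2 + (N - 1) / 3 * (9 / 4 / N ^ 2)).
    { apply Rplus_le_compat.
      - right. replace 2.25 with (9 / 4) by lra. reflexivity.
      - apply Rmult_le_compat_l; [lra|]. replace (9 / 4) with 2.25 by lra. exact X. }
    apply Rmult_le_reg_r with (N ^ 2 * (N + 1) ^ 2); [nra|].
    replace ((9 / 4 * (N - 1) / (N + 1) ^ 2 + (N - 1) / 3 * (9 / 4 / N ^ 2)) * (N ^ 2 * (N + 1) ^ 2))
      with (9 / 4 * (N - 1) * N ^ 2 + (N - 1) * (3 / 4) * (N + 1) ^ 2) by (field; repeat split; lra).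
    replace (3 / N * (N ^ 2 * (N + 1) ^ 2)) with (3 * N * (N + 1) ^ 2) by (field; repeat split; lra).
    nra.
Qed.

(** Here [x] stands for [lambda_2 / (k(k-1))] and [h] for the lower bound on the spectrum of the
    expected Hessian. The bound on [x] comes from the trace of the Laplacian, and the inequality
    with [b ^ 2] says that the claimed error is below the squared diameter of the box. *)
Lemma tail_parameters (n : nat) (b x h : R) : (4 <= n)%nat -> 0 < b -> 0 < x -> 0 < h ->
  x * (INR n - 1) <= INR n ->
  2 * exp (2 * b) * (ln (INR n) + 2) <= x * b ^ 2 * h ->
  exists (s : R) (k : nat),
    0 < s < 1 /\ s ^ 2 = (1 + b) ^ 2 * exp (- (2 * b)) * (x / (ln (INR n) + 2)) /\
    6 * INR (S k) <= 2 * h /\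
    (2 + 2 / h) * (INR n - 1) / (INR n + 1) ^ 2 +
    (INR n - 1) / 3 * (3 / (2 * h * (1 - s) ^ 2)) ^ (S k) * odd_fact (S k) <= 3 / INR n.
Proof.
  intros Hn Hb Hx Hh Hxn Hnt. pose proof (tail_root_lower n Hn) as R0.
  pose proof (tail_sum_le n Hn) as TS. unfold tailA in TS.
  assert (N4 : 4 <= INR n) by (apply (le_INR 4) in Hn; simpl in Hn; lra).
  set (N := INR n) in *. set (L := ln N + 2) in *.
  assert (HL : 2 < L). { unfold L. pose proof (ln_increasing 1 N). rewrite ln_1 in *. lra. }
  set (v := sqrt (L * (N - 1) / N)) in *.
  set (w := sqrt (L / x)).
  assert (HLx : 0 < L / x) by (apply Rdiv_lt_0_compat; lra).
  assert (Hvw : v <= w).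
  { apply sqrt_le_1_alt. apply Rmult_le_reg_r with (N * x); [nra|].
    replace (L * (N - 1) / N * (N * x)) with (L * (x * (N - 1))) by (field; repeat split; lra).
    replace (L / x * (N * x)) with (L * N) by (field; repeat split; lra). nra. }
  assert (Hw : 1.55 <= w) by lra.
  assert (Hw2 : w ^ 2 = L / x) by (apply pow2_sqrt; lra).
  pose proof (exp_tangent_bound w b Hw ltac:(lra)) as T.
  pose proof (exp_pos b) as Eb.
  assert (E2 : exp (2 * b) = exp b ^ 2) by (replace (2 * b) with (b + b) by ring; rewrite exp_plus; ring).
  (* The positive root of the prescribed [s ^ 2]. [exp_tangent_bound] says more than
     [1 + b < w e^b]: it keeps a surplus proportional to [b], which bounds [1 - s] below. *)
  set (s := (1 + b) / (exp b * w)).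
  assert (Hew : 0 < exp b * w) by nra.
  assert (Hs : 0 < s < 1).
  { split; [apply Rdiv_lt_0_compat; lra|]. unfold s.
    apply Rmult_lt_reg_r with (exp b * w); [lra|].
    replace ((1 + b) / (exp b * w) * (exp b * w)) with (1 + b) by (field; repeat split; nra). nra. }
  set (A := 4 * (2.71 * v - 2.2) ^ 2) in *.
  assert (HA : 16 <= A) by (unfold A; nra).
  assert (HY : A <= 2 * h * (1 - s) ^ 2).
  (* The surplus [t1] bounds [(1 - s) e^b w] below by a multiple of [b], and [t2] bounds [h] below
     by a multiple of [(e^b w / b)^2]. In [h (1 - s)^2] the unknown [b] cancels, and [w >= v] leaves
     a quantity in [n] alone. *)
  { assert (t1 : (2.71 * w - 2.2) * b <= (1 - s) * (exp b * w)).
    { unfold s. replace ((1 - (1 + b) / (exp b * w)) * (exp b * w)) with (exp b * w - (1 + b)) by (field; repeat split; nra). lra. }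
    assert (t2 : 4 * (exp b * w) ^ 2 <= 2 * h * b ^ 2).
    { replace ((exp b * w) ^ 2) with (exp (2 * b) * w ^ 2) by (rewrite E2; ring). rewrite Hw2.
      apply Rmult_le_reg_r with x; [lra|].
      replace (4 * (exp (2 * b) * (L / x)) * x) with (2 * (2 * exp (2 * b) * L)) by (field; repeat split; lra).
      lra. }
    assert (t3 : 0 <= (2.71 * w - 2.2) * b) by nra.
    assert (t4 : ((2.71 * w - 2.2) * b) ^ 2 <= ((1 - s) * (exp b * w)) ^ 2) by (apply pow_incr; lra).
    assert (t5 : A <= 4 * (2.71 * w - 2.2) ^ 2).
    { unfold A. assert ((2.71 * v - 2.2) ^ 2 <= (2.71 * w - 2.2) ^ 2) by (apply pow_incr; lra). lra. }
    eapply Rle_trans; [exact t5|].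
    apply Rmult_le_reg_r with (b ^ 2); [nra|].
    apply Rle_trans with (4 * ((1 - s) * (exp b * w)) ^ 2).
    - replace (4 * (2.71 * w - 2.2) ^ 2 * b ^ 2) with (4 * ((2.71 * w - 2.2) * b) ^ 2) by ring. lra.
    - replace (4 * ((1 - s) * (exp b * w)) ^ 2) with ((1 - s) ^ 2 * (4 * (exp b * w) ^ 2)) by ring.
      replace (2 * h * (1 - s) ^ 2 * b ^ 2) with ((1 - s) ^ 2 * (2 * h * b ^ 2)) by ring.
      apply Rmult_le_compat_l; [nra|exact t2]. }
  assert (Hh8 : A <= 2 * h).
  { eapply Rle_trans; [exact HY|]. assert ((1 - s) ^ 2 <= 1) by nra. nra. }
  destruct (odd_fact_tail A (2 * h * (1 - s) ^ 2) ltac:(lra) HY) as [k [K1 K2]].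
  exists s, k. split; [exact Hs|]. split; [|split].
  - unfold s. rewrite exp_Ropp, E2.
    replace (((1 + b) / (exp b * w)) ^ 2) with ((1 + b) ^ 2 / (exp b ^ 2 * w ^ 2)) by (field; repeat split; nra).
    rewrite Hw2. field. repeat split; nra.
  - lra.
  - eapply Rle_trans; [|exact TS]. apply Rplus_le_compat.
    (* [A >= 16] gives [h >= 8], hence [2 + 2 / h <= 2.25]. *)
    + unfold Rdiv. apply Rmult_le_compat_r.
      * left. apply Rinv_0_lt_compat. nra.
      * apply Rmult_le_compat_r; [lra|].
        assert (/ h <= / 8) by (apply Rinv_le_contravar; lra). lra.
    + rewrite Rmult_assoc. apply Rmult_le_compat_l; [lra|exact K2].
Qed.

End Logistic.

Module Concentration.
Import all_boot all_order all_algebra.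
Import lra ring zify Rstruct.
Import Order.TTheory GRing.Theory Num.Theory.
Set Implicit Arguments.
Unset Strict Implicit.
Unset Printing Implicit Defensive.
Local Open Scope ring_scope.

(** * Concentration for sums of independent matrices and vectors *)

Section TraceInequalities.
Variables (R : realFieldType) (d : nat).
Implicit Types (A B W : 'M[R]_d) (v : 'cV[R]_d).

Definition frob m n (A B : 'M[R]_(m, n)) : R := \tr (A^T *m B).

Lemma frobE m n (A B : 'M[R]_(m, n)) : frob A B = \sum_i \sum_j A i j * B i j.
Proof.
rewrite /frob /mxtrace exchange_big; apply: eq_bigr => j _ /=.
by rewrite !mxE; apply: eq_bigr => i _; rewrite !mxE.
Qed.

Lemma frob_sq_ge0 m n (A : 'M[R]_(m, n)) : 0 <= frob A A.
Proof.
rewrite frobE; apply: sumr_ge0 => i _; apply: sumr_ge0 => j _.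
by rewrite -expr2 sqr_ge0.
Qed.

Lemma frob_sym m n (A B : 'M[R]_(m, n)) : frob A B = frob B A.
Proof. by rewrite !frobE; do 2!(apply: eq_bigr => ? _); rewrite mulrC. Qed.

Lemma frobDr m n (A B C : 'M[R]_(m, n)) : frob A (B + C) = frob A B + frob A C.
Proof. by rewrite /frob mulmxDr mxtraceD. Qed.

Lemma frobZr m n a (A B : 'M[R]_(m, n)) : frob A (a *: B) = a * frob A B.
Proof. by rewrite /frob -scalemxAr mxtraceZ. Qed.

Lemma frobDl m n (A B C : 'M[R]_(m, n)) : frob (B + C) A = frob B A + frob C A.
Proof. by rewrite frob_sym frobDr !(frob_sym A). Qed.

Lemma frobZl m n a (A B : 'M[R]_(m, n)) : frob (a *: B) A = a * frob B A.
Proof. by rewrite frob_sym frobZr (frob_sym A). Qed.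

Lemma frob_le_avg m n (A B : 'M[R]_(m, n)) :
  2 * frob A B <= frob A A + frob B B.
Proof.
have := frob_sq_ge0 (A - B); rewrite -scaleN1r.
rewrite !(frobDr, frobDl, frobZr, frobZl) (frob_sym B A); lra.
Qed.

Lemma frob_eq0_orth m n (A B : 'M[R]_(m, n)) : frob A A = 0 -> frob A B = 0.
Proof.
move/eqP; rewrite frobE psumr_eq0 => [|i _]; last first.
  by apply: sumr_ge0 => j _; rewrite -expr2 sqr_ge0.
move/allP => h; rewrite frobE big1 // => i _.
have := h i (mem_index_enum _); rewrite implyTb psumr_eq0 => [|j _]; last first.
  by rewrite -expr2 sqr_ge0.
move/allP => h2; rewrite big1 // => j _.
have := h2 j (mem_index_enum _).
by rewrite /= mulf_eq0 orbb => /eqP ->; rewrite mul0r.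
Qed.

Lemma frob_cauchy m n (A B : 'M[R]_(m, n)) :
  frob A B ^+ 2 <= frob A A * frob B B.
Proof.
have [/eqP A0|A0] := boolP (frob A A == 0).
  by rewrite (frob_eq0_orth B A0) A0 expr2 !mul0r.
have Apos : 0 < frob A A by rewrite lt_neqAle eq_sym A0 frob_sq_ge0.
have := frob_sq_ge0 (frob A A *: B - frob A B *: A); rewrite -scaleNr.
rewrite !(frobDr, frobDl, frobZr, frobZl) (frob_sym B A) => h.
rewrite -subr_ge0 -(pmulr_rge0 _ Apos).
by apply: le_trans h _; rewrite le_eqVlt; apply/orP; left; apply/eqP; ring.
Qed.

Lemma trmxX A k : (A ^+ k)^T = A^T ^+ k.
Proof.
elim: k => [|k ih]; first by rewrite !expr0 trmx1.
by rewrite exprS trmx_mul ih [RHS]exprSr.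
Qed.

Lemma exprB_telescope (x y : 'M[R]_d) k :
  x ^+ k.+1 - y ^+ k.+1 = \sum_(i < k.+1) x ^+ i * (x - y) * y ^+ (k - i).
Proof.
elim: k => [|k ih].
  by rewrite big_ord_recl big_ord0 /= !expr0 !expr1 mul1r mulr1 addr0.
rewrite big_ord_recl /= expr0 mul1r subn0.
have -> : \sum_(i < k.+1) x ^+ bump 0 i * (x - y) * y ^+ (k.+1 - bump 0 i)
   = x * \sum_(i < k.+1) x ^+ i * (x - y) * y ^+ (k - i).
  rewrite mulr_sumr; apply: eq_bigr => i _.
  by rewrite /bump /= add1n subSS exprS !mulrA.
by rewrite -ih mulrBr mulrBl -!exprS [RHS]addrC addrA subrK.
Qed.

(** Discrete Hermite-Hadamard: by convexity each pair [f j + f (q - j)] is at most the pair of end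
    values. *)
Lemma convex_seq_sum (f : nat -> R) q :
  (forall j, (j.+2 <= q)%N -> 2 * f j.+1 <= f j + f j.+2) ->
  2 * \sum_(j < q.+1) f j <= q.+1%:R * (f 0%N + f q).
Proof.
move=> cvx.
have incr i j : (i <= j)%N -> (j < q)%N -> f i.+1 - f i <= f j.+1 - f j.
  elim: j => [|j ih]; first by rewrite leqn0 => /eqP ->.
  rewrite leq_eqVlt => /orP[/eqP -> //|]; rewrite ltnS => ij jq.
  by have := ih ij (ltnW jq); have := cvx j jq; lra.
have shift a c l : (a <= c)%N -> (c + l <= q)%N ->
    f (a + l)%N - f a <= f (c + l)%N - f c.
  move=> ac; elim: l => [|l ih] cl; first by rewrite !addn0 !subrr.
  rewrite !addnS in cl *; have := ih (ltnW cl).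
  by have := incr (a + l)%N (c + l)%N; rewrite leq_add2r => /(_ ac cl); lra.
have pair j : (j <= q)%N -> f j + f (q - j)%N <= f 0%N + f q.
  move=> jq; have := shift 0%N (q - j)%N j (leq0n _).
  by rewrite subnK // => /(_ (leqnn _)); rewrite add0n; lra.
have -> : 2 * \sum_(j < q.+1) f j = \sum_(j < q.+1) (f j + f (q - j)%N).
  rewrite big_split /= mulrC mulr_natr mulr2n; congr (_ + _).
  rewrite (reindex_inj rev_ord_inj) /=.
  by apply: eq_bigr => i _; rewrite subSS.
apply: le_trans (ler_sum _ _) _ => [i _|].
  by apply: (pair i); rewrite -ltnS ltn_ord.
by rewrite sumr_const card_ord mulr_natl.
Qed.

(** With [B = W - W'] the left side is twice the sum of [phi i = tr(B W^i B W'^(2q-i))]. At even [i]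
    this is a squared Frobenius norm, and these values are convex in [i], so the mean of all [phi i]
    is at most that of the two ends. For odd [i] there is no such norm, as [W] and [W'] may be
    indefinite; those terms are compared with their even neighbours. *)
Lemma mxtrace_exp_diff_le W W' q : W^T = W -> W'^T = W' ->
  2 * \tr ((W - W') *m (W ^+ (q.*2).+1 - W' ^+ (q.*2).+1)) <=
  (q.*2).+1%:R * (\tr ((W - W') *m (W - W') *m W ^+ q.*2)
           + \tr ((W - W') *m (W - W') *m W' ^+ q.*2)).
Proof.
move=> sW sW'; set B := W - W'.
have sB : B^T = B by rewrite /B linearB /= sW sW'.
pose phi i := \tr (B *m (W ^+ i *m B *m W' ^+ (q.*2 - i))).
have sX k : (W ^+ k)^T = W ^+ k by rewrite trmxX sW.
have sX' k : (W' ^+ k)^T = W' ^+ k by rewrite trmxX sW'.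
have phi_frob i j i' j' : (i + i' + (j + j') = q.*2)%N ->
   phi (i + i')%N = frob (W ^+ i *m B *m W' ^+ j) (W ^+ i' *m B *m W' ^+ j').
  move=> e; rewrite /phi /frob !trmx_mul sX sX' sB -e addKn.
  have -> : W ^+ (i + i') = W ^+ i *m W ^+ i' by rewrite exprD.
  have -> : W' ^+ (j + j') = W' ^+ j' *m W' ^+ j by rewrite addnC exprD.
  by rewrite !mulmxA mxtrace_mulC !mulmxA.
(* [phi] becomes a Frobenius product of [W^i B W'^j] and [W^i' B W'^j'], both of total exponent [q],
   and is at most the mean of their squared norms. *)
have mid i j i' j' : (i + i' + (j + j') = q.*2)%N -> (i + j = i' + j')%N ->
    2 * phi (i + i')%N <= phi i.*2 + phi i'.*2.
  move=> e e'; rewrite (phi_frob _ _ _ _ e) -!addnn.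
  rewrite (phi_frob i j i j) ?(phi_frob i' j' i' j'); first exact: frob_le_avg.
    by lia.
  by lia.
have -> : \tr (B *m (W ^+ q.*2.+1 - W' ^+ q.*2.+1)) = \sum_(i < q.*2.+1) phi i.
  by rewrite exprB_telescope mulmx_sumr raddf_sum.
have -> : \tr (B *m B *m W ^+ q.*2) = phi q.*2.
  by rewrite /phi subnn expr0 mulmx1 -[B *m B *m _]mulmxA mxtrace_mulC -mulmxA.
have -> : \tr (B *m B *m W' ^+ q.*2) = phi 0%N.
  by rewrite /phi subn0 expr0 mul1mx mulmxA.
pose f j := phi j.*2.
have cvx : 2 * \sum_(j < q.+1) f j <= q.+1%:R * (f 0%N + f q).
  apply: convex_seq_sum => j jq; rewrite /f.
  have -> : (j.+1).*2 = (j + j.+2)%N by lia.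
  apply: (mid j (q - j)%N j.+2 (q - j.+2)%N).
    by rewrite addnACA !subnKC // ?addnn // ltnW // ltnW.
  by rewrite !subnKC // ltnW // ltnW.
have split_sum : \sum_(i < q.*2.+1) phi i =
    \sum_(j < q.+1) f j + \sum_(j < q) phi (j.*2).+1.
  elim: (q) => [|q' ih]; first by rewrite !big_ord_recl !big_ord0 /= !addr0.
  rewrite doubleS !big_ord_recr /= in ih *; rewrite ih /f doubleS; lra.
have odd_le : 2 * \sum_(j < q) phi (j.*2).+1 <= \sum_(j < q) (f j + f j.+1).
  rewrite mulr_sumr; apply: ler_sum => j _.
  have -> : j.*2.+1 = (j + j.+1)%N by rewrite addnS addnn.
  apply: (mid j (q - j)%N j.+1 (q - j.+1)%N).
    by rewrite addnACA !subnKC // ?addnn // ltnW.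
  by rewrite !subnKC // ltnW.
have tel : \sum_(j < q) (f j + f j.+1) = 2 * \sum_(j < q.+1) f j - (f 0%N + f q).
  elim: (q) => [|q' ih]; first by rewrite big_ord0 big_ord_recl big_ord0; lra.
  by rewrite !big_ord_recr /= in ih *; rewrite ih; lra.
have e : phi q.*2 + phi 0%N = f 0%N + f q by rewrite /f addrC.
have e1 : q.*2.+1%:R = 2 * q%:R + 1 :> R by rewrite -natr1 -mul2n natrM.
have e2 : q.+1%:R = q%:R + 1 :> R by rewrite -natr1.
by rewrite split_sum e e1; move: cvx odd_le; rewrite tel e2; lra.
Qed.

(* For v with v^T W v <= -t |v|^2 the moments of W at v grow at least like t^2, by log-convexity. *)
Lemma mxtrace_exp_ge W v (t : R) p : W^T = W -> 0 <= t -> v != 0 ->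
  \tr (v^T *m W *m v) <= - t * \tr (v^T *m v) -> t ^+ p.*2 <= \tr (W ^+ p.*2).
Proof.
move=> sW t0 v0 hv.
have sX k : (W ^+ k)^T = W ^+ k by rewrite trmxX sW.
pose a i := \tr (v^T *m W ^+ i *m v).
have aE i j : a (i + j)%N = frob (W ^+ i *m v) (W ^+ j *m v).
  rewrite /a /frob trmx_mul sX; congr (\tr _).
  have -> : W ^+ (i + j) = W ^+ i *m W ^+ j by rewrite exprD.
  by rewrite !mulmxA.
have aC i j : a (i + j)%N ^+ 2 <= a (i + i)%N * a (j + j)%N.
  by rewrite !aE; apply: frob_cauchy.
have vpos : 0 < a 0%N.
  rewrite (aE 0%N 0%N) expr0 mul1mx lt_neqAle frob_sq_ge0 andbT eq_sym.
  apply: contraNneq v0 => v0; apply/eqP/matrixP => i j; rewrite mxE.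
  have := frob_eq0_orth (delta_mx i j) v0.
  rewrite frobE (bigD1 i) //= (bigD1 j) //= !mxE !eqxx mulr1.
  rewrite !big1 ?addr0 // => [i' /negPf ne|j' /negPf ne].
    by rewrite big1 // => j' _; rewrite mxE ne mulr0.
  by rewrite mxE ne andbF mulr0.
(* Cauchy-Schwarz makes quotients of consecutive even moments nondecreasing, and the hypothesis on
   [v] makes the first one at least [t ^+ 2]; vanishing moments are handled apart. *)
have step j : t ^+ 2 * a (j + j)%N <= a (j.+1 + j.+1)%N /\ 0 <= a (j + j)%N.
  elim: j => [|j [ih ih0]].
    split; last exact: ltW.
    have a1 : a 1%N <= - t * a 0%N by rewrite /a expr1 expr0 mulmx1.
    have /(le_trans _) h : a 1%N ^+ 2 <= a 0%N * a 2%N := aC 0%N 1%N.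
    rewrite -(ler_pM2l vpos); apply: h.
    have -> : a 0%N * (t ^+ 2 * a (0 + 0)%N) = (t * a 0%N) ^+ 2 by rewrite addn0; ring.
    rewrite -[leRHS]sqrrN; have ta : 0 <= t * a 0%N by rewrite mulr_ge0 // ltW.
    by rewrite lerXn2r // ?nnegrE; lra.
  have h0 : 0 <= a (j.+1 + j.+1)%N by rewrite aE frob_sq_ge0.
  split=> //.
  have [/eqP z|nz] := boolP (a (j.+1 + j.+1)%N == 0).
    by rewrite z mulr0 aE frob_sq_ge0.
  have pos : 0 < a (j.+1 + j.+1)%N by rewrite lt_neqAle eq_sym nz.
  have h := aC j j.+2; rewrite addnS -addSn in h.
  have posj : 0 < a (j + j)%N.
    rewrite lt_neqAle ih0 andbT eq_sym; apply/eqP => z.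
    by have := exprn_gt0 2 pos; rewrite ltNge => /negP; apply; rewrite z mul0r in h.
  rewrite -(ler_pM2l posj); apply: le_trans h.
  by rewrite mulrCA mulrA expr2 ler_wpM2r.
have grow j : (t ^+ 2) ^+ j * a 0%N <= a (j + j)%N.
  elim: j => [|j ih]; first by rewrite expr0 mul1r.
  rewrite exprS -mulrA; apply: le_trans (step j).1.
  by rewrite ler_wpM2l // sqr_ge0.
(* [|W^p v|^2] is at most [|v|^2] times the squared Frobenius norm of [W^p], row by row. *)
have up : a (p + p)%N <= \tr (W ^+ p.*2) * a 0%N.
  rewrite aE (aE 0%N 0%N) expr0 mul1mx -addnn.
  have -> : \tr (W ^+ (p + p)) = frob (W ^+ p) (W ^+ p).
    by rewrite /frob sX exprD.
  rewrite !frobE.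
  have e (u : 'cV[R]_d) : \sum_i \sum_j u i j * u i j = \sum_i u i 0 ^+ 2.
    by apply: eq_bigr => i _; rewrite big_ord1 expr2.
  rewrite !e mulr_suml; apply: ler_sum => i _.
  have := frob_cauchy (row i (W ^+ p))^T v; rewrite !frobE !e.
  have -> : \sum_i0 \sum_j (row i (W ^+ p))^T i0 j * v i0 j = (W ^+ p *m v) i 0.
    by rewrite mxE; apply: eq_bigr => k _; rewrite big_ord1 !mxE.
  move=> h; apply: le_trans h _; rewrite le_eqVlt; apply/orP; left; apply/eqP.
  by congr (_ * _); apply: eq_bigr => k _; rewrite !mxE expr2.
rewrite -(ler_pM2r vpos) -[X in t ^+ X]mul2n exprM; exact: le_trans (grow p) up.
Qed.

End TraceInequalities.

(** * Expectation under a finite product measure *)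

Section ProductExpectation.
Variables (R : realFieldType) (P : finType).

Definition expect m (q : 'I_m -> P -> R) (F : {ffun 'I_m -> P} -> R) : R :=
  \sum_(w : {ffun 'I_m -> P}) (\prod_t q t (w t)) * F w.

Definition fcons m (p : P) (w : {ffun 'I_m -> P}) : {ffun 'I_m.+1 -> P} :=
  [ffun i => if unlift ord0 i is Some j then w j else p].

Definition resample m (k : 'I_m) (p : P) (w : {ffun 'I_m -> P}) : {ffun 'I_m -> P} :=
  [ffun t => if t == k then p else w t].

Lemma fcons0 m p (w : {ffun 'I_m -> P}) : fcons p w ord0 = p.
Proof. by rewrite ffunE unlift_none. Qed.

Lemma fconsS m p (w : {ffun 'I_m -> P}) j : fcons p w (lift ord0 j) = w j.
Proof. by rewrite ffunE liftK. Qed.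

Lemma expect_recl m (q : 'I_m.+1 -> P -> R) F :
  expect q F =
  \sum_p q ord0 p * expect (fun j => q (lift ord0 j)) (fun w => F (fcons p w)).
Proof.
rewrite /expect.
under [RHS]eq_bigr => p _ do rewrite mulr_sumr.
rewrite pair_big /=.
rewrite (reindex (fun u : P * {ffun 'I_m -> P} => fcons u.1 u.2)) /=; last first.
  exists (fun w => (w ord0, [ffun j => w (lift ord0 j)])) => [[p w] _|w _] /=.
    rewrite fcons0; congr (_, _); apply/ffunP => j; by rewrite ffunE fconsS.
  apply/ffunP => i; rewrite ffunE; case: unliftP => [j|] -> //; by rewrite ffunE.
apply: eq_bigr => [[p w] _] /=; rewrite big_ord_recl fcons0 -mulrA.
by congr (_ * (_ * _)); apply: eq_bigr => j _; rewrite fconsS.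
Qed.

Section Fixed.
Variables (m : nat) (q : 'I_m -> P -> R).
Hypothesis q_ge0 : forall t p, 0 <= q t p.
Hypothesis q_sum1 : forall t, \sum_p q t p = 1.

Lemma eq_expect F G : F =1 G -> expect q F = expect q G.
Proof. by move=> e; apply: eq_bigr => w _; rewrite e. Qed.

Lemma expectD F G : expect q (fun w => F w + G w) = expect q F + expect q G.
Proof. by rewrite -big_split; apply: eq_bigr => w _; rewrite mulrDr. Qed.

Lemma expectZ a F : expect q (fun w => a * F w) = a * expect q F.
Proof. by rewrite mulr_sumr; apply: eq_bigr => w _; rewrite mulrCA. Qed.

Lemma expect_sum (I : finType) (F : I -> {ffun 'I_m -> P} -> R) :
  expect q (fun w => \sum_i F i w) = \sum_i expect q (F i).
Proof. by rewrite exchange_big; apply: eq_bigr => w _; rewrite mulr_sumr. Qed.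

Lemma expect_cst c : expect q (fun => c) = c.
Proof.
by rewrite /expect -mulr_suml -(bigA_distr_bigA q) big1 ?mul1r.
Qed.

Lemma expect_le F G : (forall w, F w <= G w) -> expect q F <= expect q G.
Proof.
by move=> h; apply: ler_sum => w _; apply: ler_wpM2l => //; apply: prodr_ge0.
Qed.

(** Exchanging the coordinate [w k] with the fresh value [p] is an involution that preserves the
    weight of the pair. *)
Lemma expect_swap k (F : {ffun 'I_m -> P} -> {ffun 'I_m -> P} -> R) :
  expect q (fun w => \sum_p q k p * F w (resample k p w)) =
  expect q (fun w => \sum_p q k p * F (resample k p w) w).
Proof.
rewrite /expect.
under eq_bigr => w _ do rewrite mulr_sumr.
under [RHS]eq_bigr => w _ do rewrite mulr_sumr.
rewrite !pair_big /=.
rewrite (reindex_inj (h := fun u => (resample k u.2 u.1, u.1 k))) /=; last first.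
  apply: (can_inj (g := fun u => (resample k u.2 u.1, u.1 k))) => [[w p]] /=.
  rewrite ffunE eqxx; congr (_, _); apply/ffunP => t; rewrite !ffunE.
  by case: eqP => [->|].
apply: eq_bigr => [[w p] _] /=.
have -> : resample k (w k) (resample k p w) = w.
  by apply/ffunP => t; rewrite !ffunE; case: eqP => [->|].
rewrite !mulrA; congr (_ * _).
rewrite (bigD1 k) //= [in RHS](bigD1 k) //= ffunE eqxx.
have -> : \prod_(i < m | i != k) q i (resample k p w i) =
          \prod_(i < m | i != k) q i (w i).
  by apply: eq_bigr => i /negPf ne; rewrite ffunE ne.
by ring.
Qed.

Lemma expect_coord k (f : P -> R) :
  expect q (fun w => f (w k)) = \sum_p q k p * f p.
Proof.
have := expect_swap k (fun w _ => f (w k)).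
rewrite (_ : expect q _ = expect q (fun w => f (w k))) => [->|]; last first.
  by apply: eq_expect => w; rewrite -mulr_suml q_sum1 mul1r.
rewrite -[RHS]expect_cst; apply: eq_expect => w.
by apply: eq_bigr => p _; rewrite ffunE eqxx.
Qed.

End Fixed.
End ProductExpectation.

(** * Trace moments of a sum of independent rank-one matrices *)

Section MatrixMoments.
Variables (R : realFieldType) (P : finType) (m d : nat).
Variable (q : 'I_m -> P -> R).
Hypothesis q_ge0 : forall t p, 0 <= q t p.
Hypothesis q_sum1 : forall t, \sum_p q t p = 1.
Variables (xi : 'I_m -> P -> 'cV[R]_d) (rho : R).
Hypothesis xi_bound : forall t p, \tr ((xi t p)^T *m xi t p) <= rho.

Let X t p : 'M[R]_d := xi t p *m (xi t p)^T.
Let H t : 'M[R]_d := \sum_p q t p *: X t p.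
Hypothesis H_sum1 : \sum_t H t = 1%:M.

(** The [W] of the overview, once [xi] is the whitened difference vector scaled by the root of the
    curvature. *)
Definition cov_dev (w : {ffun 'I_m -> P}) : 'M[R]_d :=
  \sum_t xi t (w t) *m (xi t (w t))^T - 1%:M.
Let W := cov_dev.
Definition cov_moment r : R := expect q (fun w => \tr (cov_dev w ^+ r)).

Let X_sym t p : (X t p)^T = X t p.
Proof. by rewrite /X trmx_mul trmxK. Qed.

Lemma cov_dev_sym w : (cov_dev w)^T = cov_dev w.
Proof.
rewrite /cov_dev linearB /= trmx1 linear_sum /=; congr (_ - _).
by apply: eq_bigr => t _; apply: X_sym.
Qed.

Let X_sq t p : X t p *m X t p = \tr ((xi t p)^T *m xi t p) *: X t p.
Proof.
rewrite /X mulmxA -[_ *m _ *m xi t p]mulmxA [(xi t p)^T *m xi t p]mx11_scalar.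
by rewrite mul_mx_scalar -scalemxAl mxtrace_scalar mulr1n.
Qed.

(** A rank-one [X] satisfies [X^2 = |xi|^2 X], hence [X^2 <= rho X] as quadratic forms. *)
Let frob_X_le t p (S : 'M[R]_d) :
  frob (X t p *m S) (X t p *m S) <= rho * \tr (X t p *m (S *m S^T)).
Proof.
rewrite /frob trmx_mul X_sym mulmxA -[S^T *m _ *m _]mulmxA X_sq.
rewrite -scalemxAr -scalemxAl mxtraceZ.
have -> : \tr (S^T *m X t p *m S) = \tr (X t p *m (S *m S^T)).
  by rewrite -mulmxA mxtrace_mulC mulmxA.
apply: ler_wpM2r => //.
have -> : \tr (X t p *m (S *m S^T)) = frob (S^T *m xi t p) (S^T *m xi t p).
  by rewrite /frob trmx_mul trmxK /X -mulmxA mxtrace_mulC !mulmxA.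
exact: frob_sq_ge0.
Qed.

Let W_diff k p w : W w - W (resample k p w) = X k (w k) - X k p.
Proof.
rewrite /W /cov_dev opprB addrA subrK (bigD1 k) //= [in X in _ - X](bigD1 k) //= ffunE eqxx.
have -> : \sum_(i < m | i != k) xi i (resample k p w i) *m (xi i (resample k p w i))^T =
          \sum_(i < m | i != k) xi i (w i) *m (xi i (w i))^T.
  by apply: eq_bigr => i /negPf ne; rewrite ffunE ne.
by rewrite opprD addrACA subrr addr0.
Qed.

(* Replacing the k-th observation by an independent copy is measure preserving,
   so E tr((X_k - E X_k) W^{2j+1}) is half of E tr((X_k - X_k')(W^{2j+1} - W'^{2j+1})). *)
Let coord_le k j :
  2 * expect q (fun w => \tr ((X k (w k) - H k) *m W w ^+ j.*2.+1)) <=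
  j.*2.+1%:R * expect q (fun w => \sum_p q k p *
     \tr ((X k (w k) - X k p) *m (X k (w k) - X k p) *m W w ^+ j.*2)).
Proof.
pose F w w' := \tr ((W w - W w') *m W w ^+ j.*2.+1).
pose G w w' := \tr ((W w - W w') *m (W w - W w') *m W w ^+ j.*2).
have -> : expect q (fun w => \tr ((X k (w k) - H k) *m W w ^+ j.*2.+1)) =
   expect q (fun w => \sum_p q k p * F w (resample k p w)).
  apply: eq_expect => w; rewrite /F.
  have e p : q k p * \tr ((W w - W (resample k p w)) *m W w ^+ j.*2.+1) =
      q k p * \tr (X k (w k) *m W w ^+ j.*2.+1) -
      \tr (q k p *: X k p *m W w ^+ j.*2.+1).
    by rewrite W_diff mulmxBl linearB /= mulrBr -scalemxAl mxtraceZ.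
  rewrite (eq_bigr _ (fun p _ => e p)) sumrB -mulr_suml q_sum1 mul1r mulmxBl linearB /=; congr (_ - _).
  by rewrite /H mulmx_suml linear_sum.
have -> : expect q (fun w => \sum_p q k p *
     \tr ((X k (w k) - X k p) *m (X k (w k) - X k p) *m W w ^+ j.*2)) =
   expect q (fun w => \sum_p q k p * G w (resample k p w)).
  by apply: eq_expect => w; apply: eq_bigr => p _; rewrite /G W_diff.
have e2 (D : {ffun 'I_m -> P} -> {ffun 'I_m -> P} -> R) :
   2 * expect q (fun w => \sum_p q k p * D w (resample k p w)) =
   expect q (fun w => \sum_p q k p * (D w (resample k p w) + D (resample k p w) w)).
  rewrite mulr_natl mulr2n [in X in _ + X]expect_swap -expectD.
  apply: eq_expect => w; rewrite -big_split; apply: eq_bigr => p _.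
  by rewrite mulrDr.
rewrite e2 -(ler_pM2l (ltr0Sn R 1)) [leRHS]mulrCA e2 -!expectZ.
apply: expect_le => // w; rewrite !mulr_sumr; apply: ler_sum => p _.
rewrite !(mulrCA _ (q k p)); apply: ler_wpM2l => //.
have := mxtrace_exp_diff_le j (cov_dev_sym w) (cov_dev_sym (resample k p w)).
rewrite /F /G /W -[cov_dev (resample k p w) - cov_dev w]opprB.
set W1 := cov_dev w; set W2 := cov_dev (resample k p w).
by rewrite !(mulNmx, mulmxN, opprK) mulmxBr !raddfB raddfN /=.
Qed.

Let W_sum w : W w = \sum_k (X k (w k) - H k).
Proof. by rewrite sumrB H_sum1. Qed.

Let moment_le j :
  2 * cov_moment j.*2.+2 <= j.*2.+1%:R * \sum_k expect q (fun w => \sum_p q k p *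
     \tr ((X k (w k) - X k p) *m (X k (w k) - X k p) *m W w ^+ j.*2)).
Proof.
have -> : cov_moment j.*2.+2 =
   \sum_k expect q (fun w => \tr ((X k (w k) - H k) *m W w ^+ j.*2.+1)).
  rewrite -expect_sum; apply: eq_expect => w.
  by rewrite exprS -[cov_dev w]/(W w) {1}W_sum mulr_suml linear_sum.
by rewrite !mulr_sumr; apply: ler_sum => k _; apply: coord_le.
Qed.

(** As quadratic forms [(X - X')^2 <= 2 X^2 + 2 X'^2 <= 2 rho (X + X')]. Averaging over the copy and
    summing over the coordinates turns [X + X'] into [W + 2], which gives the two moments on the
    right. *)
Lemma cov_moment_rec j : cov_moment j.*2.+2 <=
  j.*2.+1%:R * rho * (cov_moment j.*2.+1 + 2 * cov_moment j.*2).
Proof.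
rewrite -(ler_pM2l (ltr0Sn R 1)); apply: le_trans (moment_le j) _.
rewrite mulrCA -mulrA; apply: ler_wpM2l; first exact: ler0n.
have -> : rho * (2 * (cov_moment j.*2.+1 + 2 * cov_moment j.*2)) =
   \sum_k expect q (fun w => 2 * rho * \tr ((X k (w k) + H k) *m W w ^+ j.*2)).
  rewrite -expect_sum.
  have -> : rho * (2 * (cov_moment j.*2.+1 + 2 * cov_moment j.*2)) =
     2 * rho * (cov_moment j.*2.+1 + 2 * cov_moment j.*2) by ring.
  rewrite -!expectZ -expectD -expectZ; apply: eq_expect => w.
  rewrite -mulr_sumr -linear_sum -mulmx_suml big_split /= H_sum1.
  have -> : \sum_i X i (w i) = W w + 1%:M by rewrite /W /cov_dev subrK.
  rewrite /W; move: (cov_dev w) => U; rewrite !mulmxDl !mul1mx !linearD /= exprS.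
  by congr (_ * _); rewrite -addrA mulr_natl mulr2n.
apply: ler_sum => k _; apply: expect_le => // w.
have -> : 2 * rho * \tr ((X k (w k) + H k) *m W w ^+ j.*2) =
   \sum_p q k p * (2 * rho * \tr ((X k (w k) + X k p) *m W w ^+ j.*2)).
  have e p : q k p * (2 * rho * \tr ((X k (w k) + X k p) *m W w ^+ j.*2)) =
      2 * rho * (q k p * \tr (X k (w k) *m W w ^+ j.*2) +
      \tr (q k p *: X k p *m W w ^+ j.*2)).
    by rewrite mulrCA mulmxDl linearD /= mulrDr -scalemxAl mxtraceZ.
  rewrite (eq_bigr _ (fun p _ => e p)) -mulr_sumr big_split /= -mulr_suml q_sum1 mul1r -linear_sum -mulmx_suml.
  by rewrite mulmxDl linearD.
apply: ler_sum => p _; apply: ler_wpM2l => //.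
have eW : W w ^+ j.*2 = W w ^+ j *m (W w ^+ j)^T.
  by rewrite trmxX cov_dev_sym -addnn exprD.
rewrite eW; set S := W w ^+ j.
have -> : \tr ((X k (w k) - X k p) *m (X k (w k) - X k p) *m (S *m S^T)) =
   frob ((X k (w k) - X k p) *m S) ((X k (w k) - X k p) *m S).
  have : (X k (w k) - X k p)^T = X k (w k) - X k p by rewrite linearB /= !X_sym.
  move: (X k (w k) - X k p) => D sD.
  by rewrite /frob trmx_mul sD mulmxA mxtrace_mulC !mulmxA.
have h1 := frob_X_le k (w k) S; have h2 := frob_X_le k p S.
have := frob_le_avg (- (X k (w k) *m S)) (X k p *m S).
rewrite mulmxBl -[X in frob X X <= _]scale1r.
rewrite -!scaleN1r !(frobDr, frobDl, frobZr, frobZl).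
rewrite (frob_sym (X k p *m S) (X k (w k) *m S)) mulmxDl linearD /=.
lra.
Qed.

(** The trace of [(W - 1)^2 W^(2j)] is nonnegative; this eliminates the odd moment from the
    recursion. *)
Lemma cov_moment_odd j :
  2 * cov_moment j.*2.+1 <= cov_moment j.*2.+2 + cov_moment j.*2.
Proof.
rewrite -expectZ -expectD; apply: expect_le => // w.
set V := cov_dev w; have := frob_sq_ge0 ((V - 1) *m V ^+ j).
have sV : V^T = V by apply: cov_dev_sym.
rewrite /frob trmx_mul linearB /= trmx1 trmxX sV.
have -> : V ^+ j *m (V - 1) *m ((V - 1) *m V ^+ j) =
   V ^+ j.*2.+2 - V ^+ j.*2.+1 *+ 2 + V ^+ j.*2.
  rewrite -![_ *m _]/(_ * _).
  have c : V ^+ j * (V - 1) = (V - 1) * V ^+ j.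
    by rewrite mulrBr mulrBl mulr1 mul1r -exprS -exprSr.
  rewrite c -mulrA [V ^+ j * (_ * _)]mulrA c -mulrA -exprD addnn mulrA -expr2.
  by rewrite sqrrB1 mulrDl mulrBl mul1r mulrnAl -exprD add2n -exprS.
rewrite linearD linearB /= raddfMn /= mulr_natl; lra.
Qed.

Let tr_X t p : \tr (X t p) = \tr ((xi t p)^T *m xi t p).
Proof. by rewrite mxtrace_mulC. Qed.

Let tr_X_ge0 t p : 0 <= \tr (X t p).
Proof. by rewrite tr_X; apply: frob_sq_ge0. Qed.

Lemma cov_moment2 : cov_moment 2 <= rho * d%:R.
Proof.
rewrite -(ler_pM2l (ltr0Sn R 1)); apply: le_trans (moment_le 0) _; rewrite mul1r.
have -> : 2 * (rho * d%:R) = \sum_k expect q (fun w => rho * (\tr (X k (w k)) + \tr (H k))).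
  have dE : d%:R = \sum_k \tr (H k) by rewrite -raddf_sum /= H_sum1 mxtrace1.
  transitivity (\sum_k rho * (\tr (H k) + \tr (H k))).
    by rewrite -mulr_sumr big_split /= -dE; ring.
  apply: eq_bigr => k _; rewrite expectZ expectD expect_cst //.
  rewrite (expect_coord q_sum1 k (fun p => \tr (X k p))); congr (_ * _).
  congr (_ + _); rewrite /H raddf_sum; apply: eq_bigr => p _ /=.
  by rewrite mxtraceZ.
apply: ler_sum => k _; apply: expect_le => // w.
have -> : rho * (\tr (X k (w k)) + \tr (H k)) =
   \sum_p q k p * (rho * (\tr (X k (w k)) + \tr (X k p))).
  under eq_bigr => p _ do rewrite mulrCA mulrDr.
  rewrite -mulr_sumr big_split /= -mulr_suml q_sum1 mul1r; congr (_ * (_ + _)).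
  by rewrite /H raddf_sum; apply: eq_bigr => p _ /=; rewrite mxtraceZ.
apply: ler_sum => p _; apply: ler_wpM2l => //.
rewrite expr0 mulmx1 mulmxBl !mulmxBr !X_sq !raddfB /= !mxtraceZ.
have cross : 0 <= \tr (X k (w k) *m X k p).
  have -> : \tr (X k (w k) *m X k p) =
     frob ((xi k p)^T *m xi k (w k)) ((xi k p)^T *m xi k (w k)).
    by rewrite /frob trmx_mul trmxK /X -mulmxA mxtrace_mulC !mulmxA.
  exact: frob_sq_ge0.
rewrite [\tr (X k p *m _)]mxtrace_mulC.
have h1 := ler_wpM2r (tr_X_ge0 k (w k)) (xi_bound k (w k)).
have h2 := ler_wpM2r (tr_X_ge0 k p) (xi_bound k p).
lra.
Qed.

Hypothesis rho_ge0 : 0 <= rho.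

Lemma cov_moment_ge0 j : 0 <= cov_moment j.*2.
Proof.
rewrite -[leLHS](expect_cst q_sum1); apply: expect_le => // w.
have -> : \tr (cov_dev w ^+ j.*2) = frob (cov_dev w ^+ j) (cov_dev w ^+ j).
  by rewrite /frob trmxX cov_dev_sym -addnn exprD.
exact: frob_sq_ge0.
Qed.

(** With [a = (2j+1) rho], the recursion and the bound on the odd moment give
    [(1 - a/2) m' <= (5/2) a m] for consecutive even moments; [a <= 1/3] turns this into the factor
    [3 a]. *)
Lemma cov_moment_step j : 3 * (j.*2.+1%:R * rho) <= 1 ->
  cov_moment j.*2.+2 <= 3 * (j.*2.+1%:R * rho) * cov_moment j.*2.
Proof.
move=> small; have h1 := cov_moment_rec j; have h2 := cov_moment_odd j.
have h3 := cov_moment_ge0 j; have h4 := cov_moment_ge0 j.+1; rewrite doubleS in h4.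
have a0 : 0 <= j.*2.+1%:R * rho by rewrite mulr_ge0.
move: (_ * rho) a0 small h1 => a a0 small h1; nra.
Qed.

(** The prefactor [1/3] records the sharper second moment, whose factor is [rho] where later steps
    have [3 rho]. *)
Lemma cov_moment_bound p : 3 * (p.*2.+1%:R * rho) <= 1 ->
  cov_moment p.+1.*2 <=
  d%:R / 3 * (3 * rho) ^+ p.+1 * \prod_(i < p.+1) i.*2.+1%:R.
Proof.
elim: p => [|p ih] small.
  rewrite big_ord_recl big_ord0 /= !mulr1 expr1; apply: le_trans cov_moment2 _.
  by rewrite le_eqVlt; apply/orP; left; apply/eqP; field.
rewrite doubleS; apply: le_trans (cov_moment_step small) _.
rewrite big_ord_recr /= exprS.
have h : 3 * (p.*2.+1%:R * rho) <= 1.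
  apply: le_trans small; rewrite ler_wpM2l // ler_wpM2r // ler_nat; lia.
have {}ih := ih h; have a0 : 0 <= p.+1.*2.+1%:R * rho by rewrite mulr_ge0.
apply: le_trans (ler_wpM2l _ ih) _; first by rewrite mulr_ge0.
rewrite le_eqVlt; apply/orP; left; apply/eqP; ring.
Qed.

End MatrixMoments.

(** * Fourth moment of a sum of independent centred vectors *)

Section VectorMoments.
Variables (R : realFieldType) (P : finType) (d : nat).

Let second m (q : 'I_m -> P -> R) (gam : 'I_m -> P -> 'I_d -> R) i j : R :=
  \sum_t \sum_p q t p * (gam t p i * gam t p j).

Lemma sum2_mul (I J : finType) (f : I -> R) (g : J -> R) :
  (\sum_i f i) * (\sum_j g j) = \sum_i \sum_j f i * g j.
Proof. by rewrite mulr_suml; apply: eq_bigr => i _; rewrite mulr_sumr. Qed.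

(** The first two terms of the last bound are the value for a Gaussian vector with the same
    covariance; [kappa] covers the fourth moments of single summands. The three claims share one
    induction, since the mixed terms of the fourth moment need the first two. *)
Lemma expect_vsum_moments m (q : 'I_m -> P -> R) (gam : 'I_m -> P -> 'I_d -> R)
  (kappa : R) :
  (forall t p, 0 <= q t p) -> (forall t, \sum_p q t p = 1) ->
  (forall t i, \sum_p q t p * gam t p i = 0) ->
  (forall t p, \sum_i gam t p i ^+ 2 <= kappa) ->
  [/\ forall i, expect q (fun w => \sum_t gam t (w t) i) = 0,
      forall i j, expect q (fun w => (\sum_t gam t (w t) i) * \sum_t gam t (w t) j) =
        \sum_t \sum_p q t p * (gam t p i * gam t p j) &
      expect q (fun w => (\sum_i (\sum_t gam t (w t) i) ^+ 2) ^+ 2) <=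
        (\sum_i second q gam i i) ^+ 2 + 2 * (\sum_i \sum_j second q gam i j ^+ 2)
        + kappa * \sum_i second q gam i i].
Proof.
elim: m q gam => [|m ih] q gam q0 q1 mean bound.
  have z (F : {ffun 'I_0 -> P} -> R) c : F =1 (fun => c) -> expect q F = c.
    move=> e; rewrite (eq_expect _ e) expect_cst // => t; exact: q1.
  have s0 i j : second q gam i j = 0 by rewrite /second big_ord0.
  split.
  - by move=> i; apply: z => w; rewrite big_ord0.
  - by move=> i j; rewrite big_ord0; apply: z => w; rewrite !big_ord0 mul0r.
  - rewrite (z _ 0) => [|w]; last by rewrite big1 ?expr0n // => i _; rewrite big_ord0 expr0n.
    rewrite !big1 ?expr0n /= ?mulr0 ?addr0 // => i _; rewrite ?big1 // => j _.
    by rewrite s0 expr0n.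
pose q' t := q (lift ord0 t); pose gam' t := gam (lift ord0 t).
have [] := ih q' gam' (fun t => q0 _) (fun t => q1 _) (fun t => mean _) (fun t => bound _).
set S := fun (w : {ffun 'I_m -> P}) i => \sum_t gam' t (w t) i => IH1 IH2 IH3.
pose C i j := second q' gam' i j.
pose g p i := gam ord0 p i; pose pi p := q ord0 p.
pose D i j := \sum_p pi p * (g p i * g p j).
have sumS p w i : \sum_t gam t (fcons p w t) i = g p i + S w i.
  by rewrite big_ord_recl fcons0; congr (_ + _); apply: eq_bigr => t _; rewrite fconsS.
have secE i j : second q gam i j = D i j + C i j by rewrite /second big_ord_recl.
have meang i : \sum_p pi p * g p i = 0 := mean ord0 i.
have E0 c : expect q' (fun => c) = c by apply: expect_cst => t; exact: q1.
split.
- move=> i; rewrite expect_recl -[RHS](meang i); apply: eq_bigr => p _; congr (_ * _).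
  rewrite (eq_expect _ (G := fun w => g p i + S w i)) => [|w]; last exact: sumS.
  by rewrite expectD E0 IH1 addr0.
- move=> i j; rewrite expect_recl big_ord_recl -[X in _ + X]/(C i j).
  transitivity (\sum_p pi p * (g p i * g p j + C i j)); last first.
    under eq_bigr => p _ do rewrite mulrDr.
    by rewrite big_split /= -mulr_suml q1 mul1r.
  apply: eq_bigr => p _; congr (_ * _).
  rewrite (eq_expect _ (G := fun w => g p i * g p j + (g p i * S w j + (g p j * S w i + S w i * S w j)))).
    by rewrite !expectD !expectZ E0 !IH1 IH2 !mulr0 !add0r.
  by move=> w; rewrite !sumS; ring.
pose N w := \sum_i S w i ^+ 2.
(* The third-order terms [N w * S w i] stay unevaluated: their factor [g p i] is centred, so they
   vanish once [p] is averaged. *)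
have bnd p : expect q' (fun w => (\sum_i (g p i + S w i) ^+ 2) ^+ 2) =
   expect q' (fun w => N w ^+ 2) + 4 * (\sum_i \sum_j g p i * g p j * C i j)
   + (\sum_i g p i ^+ 2) ^+ 2 + 2 * (\sum_i g p i ^+ 2) * (\sum_i C i i)
   + 4 * \sum_i g p i * expect q' (fun w => N w * S w i).
  pose A := \sum_i g p i ^+ 2.
  rewrite (eq_expect _ (G := fun w => N w ^+ 2 + (4 * (\sum_i \sum_j g p i * g p j * (S w i * S w j))
    + (A ^+ 2 + (2 * A * (\sum_i S w i * S w i) + (4 * (\sum_i g p i * (N w * S w i))
    + 4 * A * \sum_i g p i * S w i)))))).
    rewrite !expectD E0 !expectZ !expect_sum.
    have -> : \sum_i expect q' (fun w => \sum_j g p i * g p j * (S w i * S w j)) =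
              \sum_i \sum_j g p i * g p j * C i j.
      apply: eq_bigr => i _; rewrite expect_sum; apply: eq_bigr => j _.
      by rewrite expectZ IH2.
    have -> : \sum_i expect q' (fun w => S w i * S w i) = \sum_i C i i.
      by apply: eq_bigr => i _; rewrite IH2.
    have -> : \sum_i expect q' (fun w => g p i * (N w * S w i)) =
       \sum_i g p i * expect q' (fun w => N w * S w i).
      by apply: eq_bigr => i _; rewrite expectZ.
    have -> : \sum_i expect q' (fun w => g p i * S w i) = 0.
      by rewrite big1 // => i _; rewrite expectZ IH1 mulr0.
    rewrite /A; ring.
  move=> w.
  have -> : \sum_i (g p i + S w i) ^+ 2 = A + 2 * (\sum_i g p i * S w i) + N w.
    rewrite /A /N mulr_sumr -!big_split; apply: eq_bigr => i _ /=; ring.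
  have -> : \sum_i \sum_j g p i * g p j * (S w i * S w j) = (\sum_i g p i * S w i) ^+ 2.
    rewrite expr2 sum2_mul; apply: eq_bigr => i _; apply: eq_bigr => j _; ring.
  have -> : \sum_i S w i * S w i = N w by apply: eq_bigr => i _; rewrite expr2.
  have -> : \sum_i g p i * (N w * S w i) = N w * (\sum_i g p i * S w i).
    by rewrite mulr_sumr; apply: eq_bigr => i _; rewrite mulrCA.
  ring.
rewrite expect_recl.
have -> : \sum_p q ord0 p * expect (fun j => q (lift ord0 j))
     (fun w => (\sum_i (\sum_t gam t (fcons p w t) i) ^+ 2) ^+ 2) =
   \sum_p pi p * expect q' (fun w => (\sum_i (g p i + S w i) ^+ 2) ^+ 2).
  apply: eq_bigr => p _; congr (_ * _); apply: eq_expect => w; congr (_ ^+ 2).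
  by apply: eq_bigr => i _; rewrite sumS.
pose TD := \sum_i D i i; pose TC := \sum_i C i i.
have -> : \sum_p pi p * expect q' (fun w => (\sum_i (g p i + S w i) ^+ 2) ^+ 2) =
  expect q' (fun w => N w ^+ 2) + 4 * (\sum_i \sum_j D i j * C i j)
  + \sum_p pi p * (\sum_i g p i ^+ 2) ^+ 2 + 2 * TD * TC.
  have e p : pi p * expect q' (fun w => (\sum_i (g p i + S w i) ^+ 2) ^+ 2) =
    pi p * expect q' (fun w => N w ^+ 2)
    + 4 * (\sum_i \sum_j pi p * (g p i * g p j) * C i j)
    + pi p * (\sum_i g p i ^+ 2) ^+ 2 + 2 * TC * (\sum_i pi p * (g p i * g p i))
    + 4 * \sum_i expect q' (fun w => N w * S w i) * (pi p * g p i).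
    rewrite bnd -/TC !mulrDr; congr (_ + _ + _ + _ + _).
    + rewrite mulrCA; congr (_ * _); rewrite mulr_sumr; apply: eq_bigr => i _.
      by rewrite mulr_sumr; apply: eq_bigr => j _; rewrite !mulrA.
    + rewrite -mulr_sumr -[in RHS](eq_bigr _ (fun i _ => expr2 (g p i))); ring.
    + rewrite mulrCA; congr (_ * _); rewrite mulr_sumr; apply: eq_bigr => i _; ring.
  rewrite (eq_bigr _ (fun p _ => e p)) !big_split /= -mulr_suml q1 mul1r -!mulr_sumr.
  have -> : \sum_p \sum_i \sum_j pi p * (g p i * g p j) * C i j =
            \sum_i \sum_j D i j * C i j.
    rewrite exchange_big; apply: eq_bigr => i _; rewrite exchange_big.
    by apply: eq_bigr => j _; rewrite mulr_suml.
  have -> : \sum_p \sum_i pi p * (g p i * g p i) = TD.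
    by rewrite exchange_big.
  have -> : \sum_p \sum_i expect q' (fun w => N w * S w i) * (pi p * g p i) = 0.
    rewrite exchange_big big1 // => i _; by rewrite -mulr_sumr meang mulr0.
  ring.
(* The mixed terms match the increment of the right-hand side exactly; this term has to fit into
   [kappa * TD], and the squares of [TD] and of the entries of [D] are given away. *)
have four : \sum_p pi p * (\sum_i g p i ^+ 2) ^+ 2 <= kappa * TD.
  have -> : kappa * TD = \sum_p pi p * (kappa * \sum_i g p i ^+ 2).
    rewrite /TD exchange_big mulr_sumr; apply: eq_bigr => p _.
    rewrite -mulr_sumr -(eq_bigr _ (fun i _ => expr2 (g p i))); ring.
  apply: ler_sum => p _; apply: ler_wpM2l; first exact: q0.
  rewrite expr2; apply: ler_wpM2r; last exact: bound.
  by apply: sumr_ge0 => i _; rewrite sqr_ge0.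
have -> : \sum_i second q gam i i = TD + TC.
  by rewrite /TD /TC -big_split; apply: eq_bigr => i _; rewrite secE.
have -> : \sum_i \sum_j second q gam i j ^+ 2 =
  \sum_i \sum_j D i j ^+ 2 + 2 * (\sum_i \sum_j D i j * C i j) + \sum_i \sum_j C i j ^+ 2.
  rewrite mulr_sumr -!big_split; apply: eq_bigr => i _ /=.
  rewrite mulr_sumr -!big_split; apply: eq_bigr => j _ /=; rewrite secE; ring.
have D2 : 0 <= \sum_i \sum_j D i j ^+ 2.
  by apply: sumr_ge0 => i _; apply: sumr_ge0 => j _; apply: sqr_ge0.
have TD2 : 0 <= TD ^+ 2 by apply: sqr_ge0.
move: IH3; rewrite -/(N _) -/TC => IH3; nra.
Qed.

End VectorMoments.

(** * Whitening of a positive definite matrix *)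

Section Whitening.
Variable R : rcfType.

Lemma mxtrace11 (A : 'M[R]_1) : \tr A = A 0 0.
Proof. by rewrite /mxtrace big_ord1. Qed.

(** Cholesky by induction: the congruence [L] clears the first row and column and leaves the Schur
    complement [S], which inherits positivity from [A]. *)
Lemma posdef_whiten d (A : 'M[R]_d) : A^T = A ->
  (forall v : 'cV[R]_d, v != 0 -> 0 < \tr (v^T *m A *m v)) ->
  exists B : 'M[R]_d, B^T *m A *m B = 1%:M.
Proof.
elim: d A => [|d ih] A symA posA.
  by exists 0; apply/matrixP => -[].
change ('M[R]_(1 + d)) in A.
have {}posA : forall v : 'cV[R]_(1 + d), v != 0 -> 0 < \tr (v^T *m A *m v) := posA.
pose a := ulsubmx A 0 0; pose b : 'M[R]_(d, 1) := dlsubmx A.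
have eA : A = block_mx a%:M b^T b (drsubmx A).
  rewrite -[LHS]submxK [ulsubmx A]mx11_scalar; congr (block_mx _ _ _ _).
  by rewrite /b trmx_dlsub symA.
set C := drsubmx A in eA.
have symC : C^T = C by rewrite trmx_drsub symA.
have a0 : 0 < a.
  have := posA (col_mx (1%:M : 'M[R]_1) (0 : 'cV[R]_d)).
  rewrite col_mx_eq0 negb_and matrix_nonzero1 => /(_ isT).
  rewrite {1}eA tr_col_mx mul_row_block mul_row_col !trmx0 !trmx1.
  by rewrite !mul0mx !mulmx0 !addr0 mul1mx mulmx1 mxtrace_scalar mulr1n.
pose L : 'M[R]_(1 + d) := block_mx 1%:M (- a^-1 *: b^T) 0 1%:M.
pose S := C - a^-1 *: (b *m b^T).
have eL : L^T *m A *m L = block_mx a%:M 0 0 S.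
  have -> : L^T = block_mx 1%:M 0 (- a^-1 *: b) 1%:M.
    by rewrite /L tr_block_mx !trmx1 trmx0 [(_ *: _)^T]linearZ /= trmxK.
  rewrite {1}eA /L !mulmx_block.
  rewrite !mul1mx !mulmx1 !mul0mx !mulmx0 !addr0 -!scalemxAl !mul_mx_scalar.
  rewrite -!scalemxAr !mul_scalar_mx !scalerA !mulNr ?mulrN ?mulVf ?mulfV ?gt_eqF //.
  rewrite !scaleN1r !addNr mul0mx scaler0 add0r; congr (block_mx _ _ _ _).
  by rewrite /S scaleNr addrC.
have [B' eB'] : exists B : 'M[R]_d, B^T *m S *m B = 1%:M.
  apply: ih => [|v v0]; first by rewrite /S linearB /= linearZ /= trmx_mul trmxK symC.
  have := posA (L *m col_mx (0 : 'M[R]_1) v).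
  have -> : (L *m col_mx (0 : 'M[R]_1) v)^T *m A *m (L *m col_mx (0 : 'M[R]_1) v) = v^T *m S *m v.
    rewrite trmx_mul -!mulmxA [A *m _]mulmxA [L^T *m _]mulmxA [L^T *m (A *m L)]mulmxA eL.
    rewrite tr_col_mx mul_block_col mul_row_col trmx0 !mul0mx ?mulmx0 !add0r.
    by rewrite mulmxA.
  apply; apply: contraNneq v0 => h; apply/eqP.
  move: h; rewrite /L mul_block_col !mulmx0 !mul1mx !add0r.
  by move/eqP; rewrite col_mx_eq0 => /andP[_ /eqP].
pose D : 'M[R]_(1 + d) := block_mx (Num.sqrt a)^-1%:M 0 0 B'.
suff key : (L *m D)^T *m A *m (L *m D) = 1%:M by exists (L *m D).
rewrite /D.
rewrite trmx_mul -!mulmxA [A *m _]mulmxA [L^T *m _]mulmxA [L^T *m (A *m L)]mulmxA eL.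
rewrite tr_block_mx !mulmx_block !trmx0 tr_scalar_mx.
rewrite ?(mul0mx, mulmx0, addr0, add0r) [B'^T *m _]mulmxA eB' -!scalar_mxM.
have -> : (Num.sqrt a)^-1 * (a * (Num.sqrt a)^-1) = 1.
  have s0 : Num.sqrt a != 0 by rewrite gt_eqF // sqrtr_gt0.
  rewrite -{2}(sqr_sqrtr (ltW a0)); field; exact: s0.
by rewrite scalar_mx_block.
Qed.

End Whitening.

(** * From a basic inequality to two tail events *)

Section QuadraticDomination.
Variables (R : rcfType) (P : finType) (m d : nat).
Variable (q : 'I_m -> P -> R).
Hypothesis q_ge0 : forall t p, 0 <= q t p.
Hypothesis q_sum1 : forall t, \sum_p q t p = 1.
Variables (z : 'I_m -> P -> 'cV[R]_d) (kap gc : 'I_m -> P -> R) (h : R).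
Hypothesis z_bound : forall t p, \tr ((z t p)^T *m z t p) <= 2.
Hypothesis kap_ge0 : forall t p, 0 <= kap t p.
Hypothesis kap_le : forall t p, kap t p <= 4^-1.
Hypothesis gc_le : forall t p, gc t p ^+ 2 <= 1.
Hypothesis gc_mean : forall t i, \sum_p q t p * (gc t p * z t p i 0) = 0.
Let Hm : 'M[R]_d := \sum_t \sum_p (q t p * kap t p) *: (z t p *m (z t p)^T).
Hypothesis gc_cov : \sum_t \sum_p (q t p * gc t p ^+ 2) *: (z t p *m (z t p)^T) = Hm.
Hypothesis h_gt0 : 0 < h.
Hypothesis Hm_ge : forall v : 'cV[R]_d, h * \tr (v^T *m v) <= \tr (v^T *m Hm *m v).

(** In coordinates whitened by [B], a bad outcome forces the squared gradient norm [G] above [T], or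
    [W] down to [-(1 - s)] in some direction. Chebyshev around the mean [d] pays for the first, the
    trace moment of order [2(p+1)] for the second. *)
Lemma quadratic_domination_tail (bad : {ffun 'I_m -> P} -> bool) (K T s : R) p :
  0 < s -> s < 1 -> d%:R < T -> 3 * p.*2.+1%:R <= 2 * h -> 0 <= K ->
  (forall w, bad w -> exists c : 'cV[R]_d,
     (\sum_t kap t (w t) * \tr ((z t (w t))^T *m c) ^+ 2 <=
      K * \sum_t gc t (w t) * \tr ((z t (w t))^T *m c)) /\
     K ^+ 2 * T / (s ^+ 2 * h) < \tr (c^T *m c)) ->
  expect q (fun w => (bad w)%:R) <=
    (2 + 2 / h) * d%:R / (T - d%:R) ^+ 2 +
    d%:R / 3 * (3 / (2 * h * (1 - s) ^+ 2)) ^+ p.+1 * \prod_(i < p.+1) i.*2.+1%:R.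
Proof.
move=> s0 s1 dT pk K0 hbad.
have symH : Hm^T = Hm.
  rewrite linear_sum; apply: eq_bigr => t _; rewrite linear_sum.
  by apply: eq_bigr => u _; rewrite linearZ /= trmx_mul trmxK.
have norm_gt0 (v : 'cV[R]_d) : v != 0 -> 0 < \tr (v^T *m v).
  move=> v0; rewrite lt_neqAle -[\tr _]/(frob v v) frob_sq_ge0 andbT eq_sym.
  apply: contraNneq v0 => /frob_eq0_orth e; apply/eqP/matrixP => i j.
  have := e (delta_mx i j); rewrite frobE (bigD1 i) //= (bigD1 j) //= !mxE !eqxx mulr1.
  rewrite !big1 ?addr0 // => [i' /negPf ne|j' /negPf ne].
    by rewrite big1 // => j' _; rewrite mxE ne mulr0.
  by rewrite mxE ne andbF mulr0.
have [B eB] : exists B : 'M[R]_d, B^T *m Hm *m B = 1%:M.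
  apply: posdef_whiten => // v v0; apply: lt_le_trans (Hm_ge v).
  by rewrite mulr_gt0 // norm_gt0.
have unitB : B \in unitmx by have /mulmx1_unit[] := eB.
(* [N] is the product of [z] with [B c], and [h |B c|^2 <= N] because [B] whitens [Hm];
   Cauchy-Schwarz then gives [h N^2 <= 2 N]. *)
have Bz_bound t u : \tr ((B^T *m z t u)^T *m (B^T *m z t u)) <= 2 / h.
  set c := B^T *m z t u; set N := \tr (c^T *m c).
  have N0 : 0 <= N by apply: frob_sq_ge0.
  have e1 : N = frob (z t u) (B *m c).
    have cT : c^T = (z t u)^T *m B by rewrite /c trmx_mul trmxK.
    by rewrite /N /frob cT -mulmxA.
  have e2 : h * frob (B *m c) (B *m c) <= N.
    apply: le_trans (Hm_ge _) _; rewrite trmx_mul -!mulmxA [Hm *m _]mulmxA.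
    by rewrite [B^T *m _]mulmxA [B^T *m (Hm *m B)]mulmxA eB mul1mx.
  have := frob_cauchy (z t u) (B *m c); rewrite -e1 => e3.
  have e4 : h * N ^+ 2 <= 2 * N.
    apply: le_trans (ler_wpM2l (ltW h_gt0) e3) _; rewrite mulrCA.
    apply: le_trans (ler_wpM2l (frob_sq_ge0 _) e2) _.
    by apply: ler_wpM2r => //; apply: z_bound.
  rewrite ler_pdivlMr //; have [/eqP ->|Nn0] := boolP (N == 0); first by rewrite mul0r.
  have Np : 0 < N by rewrite lt_neqAle eq_sym Nn0.
  by rewrite -(ler_pM2l Np); move: e4; rewrite expr2; lra.
pose xi t u : 'cV[R]_d := Num.sqrt (kap t u) *: (B^T *m z t u).
have xiT t u : (xi t u)^T = Num.sqrt (kap t u) *: (B^T *m z t u)^T by exact: linearZ.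
pose gam t u i : R := gc t u * (B^T *m z t u) i 0.
(* The curvature is at most [1/4] and the whitened vector has squared norm at most [2 / h]. *)
pose rho := (2 * h)^-1.
have rho0 : 0 <= rho by rewrite invr_ge0 mulr_ge0 // ltW.
have whiteE (a : 'I_m -> P -> R) :
   \sum_t \sum_u (q t u * a t u) *: ((B^T *m z t u) *m (B^T *m z t u)^T) =
   B^T *m (\sum_t \sum_u (q t u * a t u) *: (z t u *m (z t u)^T)) *m B.
  rewrite mulmx_sumr mulmx_suml; apply: eq_bigr => t _.
  rewrite mulmx_sumr mulmx_suml; apply: eq_bigr => u _.
  by rewrite -scalemxAr -scalemxAl trmx_mul trmxK !mulmxA.
have xi_bound t u : \tr ((xi t u)^T *m xi t u) <= rho.
  rewrite xiT /xi -scalemxAl -scalemxAr scalerA -expr2 sqr_sqrtr // mxtraceZ.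
  apply: le_trans (_ : 4^-1 * (2 / h) <= _).
    by apply: ler_pM => //; exact: frob_sq_ge0.
  rewrite le_eqVlt; apply/orP; left; apply/eqP; rewrite /rho; field; exact: lt0r_neq0.
have xi_cov : \sum_t \sum_u q t u *: (xi t u *m (xi t u)^T) = 1%:M.
  rewrite -eB -whiteE; apply: eq_bigr => t _; apply: eq_bigr => u _.
  rewrite xiT /xi -scalemxAl -scalemxAr !scalerA; congr (_ *: _).
  by rewrite -mulrA -expr2 sqr_sqrtr.
have gam_mean t i : \sum_u q t u * gam t u i = 0.
  rewrite /gam; under eq_bigr => u _ do rewrite mxE mulrA mulr_sumr.
  rewrite exchange_big big1 // => j _.
  transitivity (B^T i j * \sum_u q t u * (gc t u * z t u j 0)).
    by rewrite mulr_sumr; apply: eq_bigr => u _; ring.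
  by rewrite gc_mean mulr0.
have gam_bound t u : \sum_i gam t u i ^+ 2 <= 2 / h.
  have -> : \sum_i gam t u i ^+ 2 = gc t u ^+ 2 * \tr ((B^T *m z t u)^T *m (B^T *m z t u)).
    rewrite -[\tr _]/(frob _ _) frobE mulr_sumr; apply: eq_bigr => i _.
    by rewrite big_ord1 /gam exprMn expr2.
  rewrite -[leRHS]mul1r; apply: ler_pM => //; [exact: sqr_ge0|exact: frob_sq_ge0].
have gam_cov i j : \sum_t \sum_u q t u * (gam t u i * gam t u j) = (i == j)%:R.
  transitivity ((1%:M : 'M[R]_d) i j); last by rewrite mxE.
  rewrite -eB -gc_cov -whiteE summxE; apply: eq_bigr => t _.
  rewrite summxE; apply: eq_bigr => u _; rewrite mxE [in RHS]mxE big_ord1 [(_^T) 0 j]mxE.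
  rewrite /gam; ring.
have [gm1 gm2 gm3] := expect_vsum_moments q_ge0 q_sum1 gam_mean gam_bound.
pose G (w : {ffun 'I_m -> P}) := \sum_i (\sum_t gam t (w t) i) ^+ 2.
have EG : expect q G = d%:R.
  rewrite expect_sum; transitivity (\sum_(i < d) (1 : R)); last first.
    by rewrite sumr_const card_ord.
  apply: eq_bigr => i _; transitivity ((i == i)%:R : R); last by rewrite eqxx.
  by rewrite -gam_cov -gm2; apply: eq_expect => w; rewrite expr2.
have sum_id : \sum_(i < d) \sum_t \sum_u q t u * (gam t u i * gam t u i) = d%:R.
  rewrite (eq_bigr (fun=> 1)) ?sumr_const ?card_ord // => i _.
  by rewrite gam_cov eqxx.
have sum_id2 : \sum_(i < d) \sum_(j < d)
    (\sum_t \sum_u q t u * (gam t u i * gam t u j)) ^+ 2 = d%:R.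
  rewrite (eq_bigr (fun=> 1)) ?sumr_const ?card_ord // => i _.
  rewrite (bigD1 i) //= gam_cov eqxx expr1n big1 ?addr0 // => j ne.
  by rewrite gam_cov eq_sym (negPf ne) expr0n.
(* The covariance is the identity, so the Gaussian terms are [d^2 + 2d] and the square of the mean
   cancels. *)
have EG2 : expect q (fun w => (G w - d%:R) ^+ 2) <= (2 + 2 / h) * d%:R.
  move: gm3; rewrite sum_id sum_id2 -/(G _) => gm3.
  rewrite (eq_expect _ (G := fun w => G w ^+ 2 + ((- (2 * d%:R)) * G w + d%:R ^+ 2))).
    rewrite !expectD expectZ EG expect_cst //; rewrite /G; lra.
  by move=> w; ring.
pose W := cov_dev xi.
have small : 3 * (p.*2.+1%:R * rho) <= 1.
  by rewrite mulrA /rho ler_pdivrMr ?mul1r ?mulr_gt0.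
have mom := cov_moment_bound q_ge0 q_sum1 xi_bound xi_cov rho0 small.
have t0 : 0 < 1 - s by rewrite subr_gt0.
have Td : 0 < T - d%:R by rewrite subr_gt0.
have point w : (bad w)%:R <= ((T - d%:R) ^+ 2)^-1 * (G w - d%:R) ^+ 2 +
    ((1 - s) ^+ p.+1.*2)^-1 * \tr (W w ^+ p.+1.*2).
  have A0 : 0 <= ((T - d%:R) ^+ 2)^-1 * (G w - d%:R) ^+ 2.
    by rewrite mulr_ge0 ?sqr_ge0 // invr_ge0 sqr_ge0.
  have B0 : 0 <= ((1 - s) ^+ p.+1.*2)^-1 * \tr (W w ^+ p.+1.*2).
    rewrite mulr_ge0 // ?invr_ge0 ?exprn_ge0 // ?(ltW t0) //.
    have -> : \tr (W w ^+ p.+1.*2) = frob (W w ^+ p.+1) (W w ^+ p.+1).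
      by rewrite /frob trmxX cov_dev_sym -addnn exprD.
    exact: frob_sq_ge0.
  case hb: (bad w); last by apply: addr_ge0.
  have [c0 [dom big]] := hbad _ hb.
  have [c c0E] : exists c, c0 = B *m c by exists (invmx B *m c0); rewrite mulKVmx.
  have T0 : 0 < T by apply: le_lt_trans dT; apply: ler0n.
  have c00 : 0 < \tr (c0^T *m c0).
    apply: le_lt_trans big; rewrite mulr_ge0 ?mulr_ge0 ?sqr_ge0 //; first exact: ltW.
    by rewrite invr_ge0 mulr_ge0 ?sqr_ge0 // ltW.
  have cn0 : c != 0.
    by apply: contraTneq c00 => e; rewrite c0E e mulmx0 mulmx0 mxtrace0 ltxx.
  have Nc := norm_gt0 _ cn0.
  have zc t u : \tr ((z t u)^T *m c0) = \tr ((B^T *m z t u)^T *m c).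
    by rewrite c0E trmx_mul trmxK mulmxA.
  have [lowW|highW] := leP (\tr (c^T *m W w *m c)) (- (1 - s) * \tr (c^T *m c)).
    have := mxtrace_exp_ge p.+1 (cov_dev_sym xi w) (ltW t0) cn0 lowW => hW.
    rewrite -[leLHS]add0r; apply: lerD => //.
    by rewrite mulrC ler_pdivlMr ?exprn_gt0 // mul1r.
  have WE : \tr (c^T *m W w *m c) =
     \sum_t kap t (w t) * \tr ((z t (w t))^T *m c0) ^+ 2 - \tr (c^T *m c).
    rewrite /W /cov_dev mulmxBr mulmx1 mulmxBl raddfB /=; congr (_ - _).
    rewrite mulmx_sumr mulmx_suml raddf_sum; apply: eq_bigr => t _ /=.
    have -> : xi t (w t) *m (xi t (w t))^T =
        kap t (w t) *: ((B^T *m z t (w t)) *m (B^T *m z t (w t))^T).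
      by rewrite xiT /xi -scalemxAl -scalemxAr scalerA -expr2 sqr_sqrtr.
    rewrite zc; move: (B^T *m z t (w t)) => y.
    rewrite -scalemxAr -scalemxAl mxtraceZ; congr (_ * _).
    have -> : c^T *m (y *m y^T) *m c = (y^T *m c)^T *m (y^T *m c).
      by rewrite trmx_mul trmxK !mulmxA.
    by rewrite !mxtrace11 mxE big_ord1 expr2 [(_^T) 0 0]mxE.
  have gE : \sum_t gc t (w t) * \tr ((z t (w t))^T *m c0) =
     \sum_i (\sum_t gam t (w t) i) * c i 0.
    under [RHS]eq_bigr => i _ do rewrite mulr_suml.
    rewrite exchange_big; apply: eq_bigr => t _.
    rewrite zc mxtrace11 mxE mulr_sumr; apply: eq_bigr => i _.
    by rewrite /gam [(_^T) 0 i]mxE mulrA.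
  have CS : (\sum_i (\sum_t gam t (w t) i) * c i 0) ^+ 2 <= G w * \tr (c^T *m c).
    have := frob_cauchy (\col_i \sum_t gam t (w t) i) c.
    rewrite -[\tr (c^T *m c)]/(frob c c) !frobE.
    have -> : \sum_i \sum_j (\col_i0 \sum_t gam t (w t) i0) i j * c i j =
       \sum_i (\sum_t gam t (w t) i) * c i 0.
      by apply: eq_bigr => i _; rewrite big_ord1 mxE.
    have -> : \sum_i \sum_j (\col_i0 \sum_t gam t (w t) i0) i j *
        (\col_i0 \sum_t gam t (w t) i0) i j = G w.
      by apply: eq_bigr => i _; rewrite big_ord1 mxE expr2.
    by [].
  (* When [W] stays above [-(1 - s)] in the direction [c], the basic inequality and Cauchy-Schwarz
     give [s^2 |c|^2 < K^2 G], while [|c|^2 >= h |c0|^2 > K^2 T / s^2]. *)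
  have TG : T < G w.
    have N1 : h * \tr (c0^T *m c0) <= \tr (c^T *m c).
      apply: le_trans (Hm_ge _) _; rewrite c0E trmx_mul -!mulmxA [Hm *m _]mulmxA.
      by rewrite [B^T *m _]mulmxA [B^T *m (Hm *m B)]mulmxA eB mul1mx.
    rewrite gE in dom; rewrite WE in highW.
    set y := \sum_i (\sum_t gam t (w t) i) * c i 0 in dom CS; set N := \tr (c^T *m c) in Nc N1 highW CS.
    have sN : s * N < K * y by move: highW dom; lra.
    have sN0 : 0 < s * N by rewrite mulr_gt0.
    have K00 : 0 < K.
      rewrite lt_neqAle K0 andbT eq_sym; apply: contraTneq (lt_trans sN0 sN) => ->.
      by rewrite mul0r ltxx.
    have sq : (s * N) ^+ 2 < K ^+ 2 * (G w * N).
      apply: lt_le_trans (_ : (K * y) ^+ 2 <= _).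
        by rewrite ltrXn2r // ?nnegrE ltW // (lt_trans sN0).
      by rewrite exprMn ler_wpM2l ?sqr_ge0.
    have sq2 : s ^+ 2 * N < K ^+ 2 * G w.
      by rewrite -(ltr_pM2r Nc); move: sq; rewrite exprMn expr2 (expr2 N); lra.
    have big2 : K ^+ 2 * T < s ^+ 2 * N.
      apply: lt_le_trans (_ : s ^+ 2 * (h * \tr (c0^T *m c0)) <= _); last first.
        by rewrite ler_wpM2l ?sqr_ge0.
      have b2 : K ^+ 2 * T < \tr (c0^T *m c0) * (s ^+ 2 * h).
        by rewrite -ltr_pdivrMr // mulr_gt0 // exprn_gt0.
      by rewrite mulrA [s ^+ 2 * h * _]mulrC.
    by have := lt_trans big2 sq2; rewrite ltr_pM2l ?exprn_gt0.
  rewrite -[leLHS]addr0; apply: lerD => //.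
  rewrite mulrC ler_pdivlMr ?exprn_gt0 // mul1r lerXn2r // ?nnegrE.
  - exact: ltW.
  - by rewrite subr_ge0 ltW // (lt_trans dT).
  - by rewrite lerB // ltW.
apply: le_trans (expect_le q_ge0 point) _.
rewrite expectD !expectZ; apply: lerD.
  by rewrite mulrC ler_wpM2r // invr_ge0 sqr_ge0.
apply: le_trans (ler_wpM2l _ mom) _; first by rewrite invr_ge0 exprn_ge0 // ltW.
rewrite le_eqVlt; apply/orP; left; apply/eqP.
have -> : 3 / (2 * h * (1 - s) ^+ 2) = (3 * rho) * ((1 - s) ^+ 2)^-1.
  by rewrite /rho invfM mulrA.
rewrite [in RHS](exprMn _ (3 * rho)) exprVn -exprM mul2n; ring.
Qed.

End QuadraticDomination.

(** * The Laplacian and the Luce model *)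

Local Notation R := Rdefinitions.R.
Local Notation exp := Rtrigo_def.exp.
Local Notation ln := Rpower.ln.

Lemma sumLE (A : Type) (l : seq A) (f : A -> R) : sumL l f = \sum_(x <- l) f x.
Proof. by elim: l => [|x l ih]; rewrite ?big_nil // big_cons -ih. Qed.

Lemma seqE a n : List.seq a n = iota a n.
Proof. by elim: n a => //= n ih a; rewrite ih. Qed.

Lemma sumL_ord n (f : nat -> R) : sumL (List.seq 0 n) f = \sum_(i < n) f i.
Proof. by rewrite sumLE seqE -[n in iota 0 n]subn0 big_mkord. Qed.

Lemma eqbE i j : Nat.eqb i j = (i == j).
Proof. by case: (PeanoNat.Nat.eqb_spec i j) => [->|/eqP/negPf]; rewrite ?eqxx. Qed.

(** * Spectral coordinates for vectors of sum zero *)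

Section Laplacian.
Variables (R : realFieldType) (d : nat) (M : 'I_d.+1 -> 'I_d.+1 -> R).
Hypothesis M_sym : forall i j, M i j = M j i.
Hypothesis M_ge0 : forall i j, 0 <= M i j.
Let n := d.+1.
Let Lap i j : R := (if i == j then \sum_c M i c else 0) - M i j.
Variables (mu : 'I_n -> R) (V : 'M[R]_n).
Hypothesis V_orth : V^T *m V = 1%:M.
Hypothesis V_eig : forall i r, \sum_c Lap r c * V c i = mu i * V r i.
Hypothesis mu_incr : forall i : 'I_n, i != ord0 -> mu (inord 1) <= mu i.
Hypothesis mu1_gt0 : 0 < mu (inord 1).

Let V_orth' : V *m V^T = 1%:M.
Proof. exact: mulmx1C. Qed.

Let rowE i j : \sum_r V i r * V j r = (i == j)%:R.
Proof.
transitivity ((V *m V^T) i j); last by rewrite V_orth' mxE.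
by rewrite mxE; apply: eq_bigr => r _; rewrite [(_^T) r j]mxE.
Qed.

Let colE i j : \sum_r V r i * V r j = (i == j)%:R.
Proof.
transitivity ((V^T *m V) i j); last by rewrite V_orth mxE.
by rewrite mxE; apply: eq_bigr => r _; rewrite [(_^T) i r]mxE.
Qed.

Let Lap_quad (v : 'I_n -> R) : \sum_i v i * \sum_c Lap i c * v c =
  2^-1 * \sum_i \sum_j M i j * (v i - v j) ^+ 2.
Proof.
have e1 : \sum_i v i * \sum_c Lap i c * v c =
   \sum_i \sum_j M i j * (v i ^+ 2) - \sum_i \sum_j M i j * (v i * v j).
  rewrite -sumrB; apply: eq_bigr => i _.
  under [X in v i * X]eq_bigr => c _ do rewrite /Lap mulrBl.
  rewrite sumrB mulrBr; congr (_ - _).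
    rewrite (bigD1 i) //= eqxx [X in _ + X]big1 => [|c ne].
      by rewrite -mulr_suml; ring.
    by rewrite eq_sym (negPf ne) mul0r.
  by rewrite mulr_sumr; apply: eq_bigr => j _; ring.
have e2 : \sum_i \sum_j M i j * (v j ^+ 2) = \sum_i \sum_j M i j * (v i ^+ 2).
  rewrite exchange_big; apply: eq_bigr => i _; apply: eq_bigr => j _.
  by rewrite M_sym.
have e3 : \sum_i \sum_j M i j * (v i - v j) ^+ 2 =
   \sum_i \sum_j M i j * (v i ^+ 2) + \sum_i \sum_j M i j * (v j ^+ 2)
   - 2 * \sum_i \sum_j M i j * (v i * v j).
  rewrite mulr_sumr -big_split -sumrB; apply: eq_bigr => i _ /=.
  rewrite mulr_sumr -big_split -sumrB; apply: eq_bigr => j _ /=; ring.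
rewrite e1 e3 e2; lra.
Qed.

Let mu_ge0 i : 0 <= mu i.
Proof.
have -> : mu i = \sum_r V r i * \sum_c Lap r c * V c i.
  under eq_bigr => r _ do rewrite V_eig mulrCA.
  by rewrite -mulr_sumr colE eqxx mulr1.
rewrite (Lap_quad (fun r => V r i)) mulr_ge0 // ?invr_ge0 //.
by apply: sumr_ge0 => a _; apply: sumr_ge0 => c _; rewrite mulr_ge0 // sqr_ge0.
Qed.

(** The columns of a Laplacian sum to zero, so [mu i] times this sum vanishes. *)
Let colsum0 i : i != ord0 -> \sum_r V r i = 0.
Proof.
move=> i0; have mi : 0 < mu i by apply: lt_le_trans (mu_incr i0).
apply/eqP; rewrite -(mulrI_eq0 _ (mulfI (lt0r_neq0 mi))) mulr_sumr.
under eq_bigr => r _ do rewrite -V_eig.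
rewrite exchange_big big1 // => c _; rewrite -mulr_suml.
have -> : \sum_r Lap r c = 0; last by rewrite mul0r.
rewrite /Lap sumrB; apply/eqP; rewrite subr_eq0 (bigD1 c) //= eqxx; apply/eqP.
rewrite [X in _ + X]big1 => [|j /negPf ->] //.
by rewrite addr0; apply: eq_bigr => j _; apply: M_sym.
Qed.

(** [U] collects the eigenvectors other than the first. Orthonormality of the rows of [V] bounds the
    difference vectors of pairs; the last clause compares the trace with the eigenvalues and bounds
    [mu_1] from above. *)
Lemma laplacian_basis : exists U : 'M[R]_(n, d),
  [/\ forall i j, \sum_r (U i r - U j r) ^+ 2 <= 2,
      forall v : 'I_n -> R, \sum_i v i = 0 ->
        forall i, v i = \sum_r U i r * \sum_j U j r * v j,
      forall c : 'I_d -> R, mu (inord 1) * \sum_r c r ^+ 2 <=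
        2^-1 * \sum_i \sum_j M i j * (\sum_r U i r * c r - \sum_r U j r * c r) ^+ 2 &
      mu (inord 1) * d%:R <= \sum_i \sum_j M i j - \sum_i M i i].
Proof.
exists (\matrix_(i, r) V i (lift ord0 r)).
have Ur i (f : 'I_d -> R) : \sum_r (\matrix_(i, r) V i (lift ord0 r)) i r * f r =
   \sum_r V i (lift ord0 r) * f r by apply: eq_bigr => r _; rewrite mxE.
split.
- move=> i j; apply: le_trans (_ : \sum_r (V i r - V j r) ^+ 2 <= _).
    rewrite [leRHS]big_ord_recl /= -[leLHS]add0r; apply: lerD; first exact: sqr_ge0.
    by apply: ler_sum => r _; rewrite !mxE.
  have -> : \sum_r (V i r - V j r) ^+ 2 =
     \sum_r V i r * V i r + \sum_r V j r * V j r - 2 * \sum_r V i r * V j r.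
    rewrite mulr_sumr -big_split -sumrB; apply: eq_bigr => r _ /=; ring.
  rewrite !rowE !eqxx; case: (i == j) => /=; lra.
- move=> v v0 i; rewrite Ur.
  (* Expanding the constant vector in the eigenbasis: it is a multiple of the first column, so sum
     zero means orthogonal to that column. *)
  have V0 j : (\sum_r V r ord0) * V j ord0 = 1.
    transitivity (\sum_r (\sum_i0 V i0 r) * V j r).
      rewrite [RHS](bigD1 ord0) //= [X in _ = _ + X]big1 ?addr0 // => r r0.
      by rewrite colsum0 // mul0r.
    under eq_bigr => r _ do rewrite mulr_suml.
    rewrite exchange_big /=; under eq_bigr => i0 _ do rewrite rowE.
    by rewrite (bigD1 j) //= eqxx big1 ?addr0 // => i0 /negPf ->.
  have v0' : \sum_j V j ord0 * v j = 0.
    have a0 : \sum_r V r ord0 != 0.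
      by apply: contra_eq_neq (V0 ord0) => ->; rewrite mul0r eq_sym oner_eq0.
    apply: (mulfI a0); rewrite mulr0 mulr_sumr -[RHS]v0; apply: eq_bigr => j _.
    by rewrite mulrA V0 mul1r.
  transitivity (\sum_r V i r * \sum_j V j r * v j); last first.
    rewrite big_ord_recl v0' mulr0 add0r; apply: eq_bigr => r _; congr (_ * _).
    by apply: eq_bigr => j _; rewrite mxE.
  under eq_bigr => r _ do rewrite mulr_sumr.
  rewrite exchange_big /=.
  under eq_bigr => j _ do under eq_bigr => r _ do rewrite mulrA.
  under eq_bigr => j _ do rewrite -mulr_suml rowE.
  rewrite (bigD1 i) //= eqxx mul1r big1 ?addr0 // => j ne.
  by rewrite eq_sym (negPf ne) mul0r.
- move=> c; pose v i := \sum_r V i (lift ord0 r) * c r.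
  have -> : 2^-1 * \sum_i \sum_j M i j * (\sum_r (\matrix_(i, r) V i (lift ord0 r)) i r * c r
      - \sum_r (\matrix_(i, r) V i (lift ord0 r)) j r * c r) ^+ 2 =
    \sum_i v i * \sum_c Lap i c * v c.
    rewrite Lap_quad; congr (_ * _); apply: eq_bigr => i _; apply: eq_bigr => j _.
    by rewrite !Ur.
  have Lv i : \sum_c Lap i c * v c = \sum_r mu (lift ord0 r) * c r * V i (lift ord0 r).
    under eq_bigr => j _ do rewrite /v mulr_sumr.
    rewrite exchange_big; apply: eq_bigr => r _ /=.
    under eq_bigr => j _ do rewrite mulrA.
    by rewrite -mulr_suml V_eig; ring.
  under [leRHS]eq_bigr => i _ do rewrite Lv mulr_sumr.
  rewrite exchange_big mulr_sumr; apply: ler_sum => r _ /=.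
  have -> : \sum_i v i * (mu (lift ord0 r) * c r * V i (lift ord0 r)) =
     mu (lift ord0 r) * c r ^+ 2.
    transitivity (mu (lift ord0 r) * c r * \sum_i v i * V i (lift ord0 r)).
      by rewrite [RHS]mulr_sumr; apply: eq_bigr => i _; rewrite mulrCA.
    rewrite /v; under eq_bigr => i _ do rewrite mulr_suml.
    rewrite exchange_big /= (bigD1 r) //= [X in _ + X]big1 => [|r' ne].
      rewrite addr0.
      transitivity (mu (lift ord0 r) * c r * (c r * \sum_i V i (lift ord0 r) * V i (lift ord0 r))).
        by congr (_ * _); rewrite mulr_sumr; apply: eq_bigr => i _; ring.
      by rewrite colE eqxx mulr1; ring.
    transitivity (c r' * \sum_i V i (lift ord0 r') * V i (lift ord0 r)).
      by rewrite mulr_sumr; apply: eq_bigr => i _; ring.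
    by rewrite colE (inj_eq lift_inj) (negPf ne) mulr0.
  by rewrite ler_wpM2r ?sqr_ge0 // mu_incr // neq_lift.
have -> : \sum_i \sum_j M i j - \sum_i M i i = \sum_i Lap i i.
  by rewrite -sumrB; apply: eq_bigr => i _; rewrite /Lap eqxx.
have -> : \sum_i Lap i i = \sum_r mu r.
  transitivity (\sum_r \sum_i (\sum_c Lap i c * V c r) * V i r).
    rewrite exchange_big; apply: eq_bigr => i _ /=.
    under eq_bigr => r _ do rewrite mulr_suml.
    rewrite exchange_big /= (bigD1 i) //= [X in _ + X]big1 => [|c ne].
      rewrite addr0; under eq_bigr => r _ do rewrite -mulrA.
      by rewrite -mulr_sumr rowE eqxx mulr1.
    under eq_bigr => r _ do rewrite -mulrA.
    by rewrite -mulr_sumr rowE (negPf ne) mulr0.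
  apply: eq_bigr => r _; under eq_bigr => i _ do rewrite V_eig -mulrA.
  by rewrite -mulr_sumr colE eqxx mulr1.
rewrite big_ord_recl -[leLHS]add0r; apply: lerD => //.
rewrite mulr_natr -[X in _ *+ X]card_ord -sumr_const; apply: ler_sum => r _.
by rewrite mu_incr // neq_lift.
Qed.

End Laplacian.

(** * Real arithmetic in the two notations *)

Lemma IZR2E : Rdefinitions.IZR (BinNums.Zpos (BinNums.xO BinNums.xH)) = 2 :> R. Proof. by rewrite IZRposE INRE. Qed.
Lemma IZR3E : Rdefinitions.IZR (BinNums.Zpos (BinNums.xI BinNums.xH)) = 3 :> R. Proof. by rewrite IZRposE INRE. Qed.
Lemma IZR6E : Rdefinitions.IZR (BinNums.Zpos (BinNums.xO (BinNums.xI BinNums.xH))) = 6 :> R. Proof. by rewrite IZRposE INRE. Qed.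
Definition RringE := (IZR2E, IZR3E, IZR6E, R0E, R1E, RpowE, RdivE, RinvE, INRE,
  RplusE, RminusE, RmultE, RoppE).

Lemma expR_gt0 (x : R) : 0 < exp x.
Proof. by apply/RltP/Exp_prop.exp_pos. Qed.

Lemma expR_add (x y : R) : exp (x + y) = exp x * exp y.
Proof. exact: Exp_prop.exp_plus. Qed.

Lemma expR_opp (x : R) : exp (- x) = (exp x)^-1.
Proof. exact: Rpower.exp_Ropp. Qed.

Lemma expR_le (x y : R) : x <= y -> exp x <= exp y.
Proof.
rewrite le_eqVlt => /orP[/eqP -> //|/RltP xy]; apply/ltW/RltP.
exact: Rpower.exp_increasing.
Qed.

Lemma odd_factE p : Logistic.odd_fact p = \prod_(i < p) i.*2.+1%:R.
Proof.
elim: p => [|p ih]; first by rewrite big_ord0.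
rewrite big_ord_recr /= -ih !RringE; congr (_ * _).
by rewrite -[RHS]natr1 -mul2n natrM.
Qed.

Lemma tail_parametersE (d : nat) (b x h : R) : (3 <= d)%N -> 0 < b -> 0 < x -> 0 < h ->
  x * d%:R <= d.+1%:R ->
  2 * exp (2 * b) * (ln d.+1%:R + 2) <= x * b ^+ 2 * h ->
  exists (s : R) (k : nat),
    [/\ 0 < s, s < 1, s ^+ 2 = (1 + b) ^+ 2 * exp (- (2 * b)) * (x / (ln d.+1%:R + 2)),
     6 * k.+1%:R <= 2 * h &
    (2 + 2 / h) * d%:R / (d.+1%:R + 1) ^+ 2 +
    d%:R / 3 * (3 / (2 * h * (1 - s) ^+ 2)) ^+ k.+1 * \prod_(i < k.+1) i.*2.+1%:R
     <= 3 / d.+1%:R].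
Proof.
move=> d3 /RltP b0 /RltP x0 /RltP h0 xd nt.
have [|||s [k [[/RltP s0 /RltP s1] [es [/RleP ek /RleP bnd]]]]] :=
  @Logistic.tail_parameters d.+1 b x h _ b0 x0 h0.
- by apply/ssrnat.leP.
- by apply/RleP; rewrite !RringE -natr1 addrK natr1.
- by apply/RleP; rewrite !RringE.
exists s, k; rewrite -odd_factE; move: es ek bnd; rewrite !RringE.
by rewrite -(natr1 d) addrK natr1 => ? ? ?; split.
Qed.

Lemma sgm_sub (x y : R) : Logistic.sgm (x - y) = exp x / (exp x + exp y).
Proof.
rewrite /Logistic.sgm !RringE opprB expR_add expR_opp.
have := expR_gt0 x; have := expR_gt0 y => Hy Hx.
by field; rewrite !lt0r_neq0 ?addr_gt0.
Qed.

(** * Score and curvature of the drawn pairs *)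

Section LuceCore.
Variables (d m k : nat).
Let n := d.+1.
Variables (S : 'I_m -> {set 'I_n}) (th : 'I_n -> R) (b : R).
Hypothesis k2 : (2 <= k)%N.
Hypothesis card_S : forall t, #|S t| = k.
Hypothesis th_bnd : forall i, - b <= th i <= b.

Let a i := exp (th i).
Let Z t := \sum_(i in S t) a i.
Definition compared t i j := [&& i \in S t, j \in S t & i != j].
(** Since the second item is uniform, the two orders of a pair have odds [a i : a j]: given the
    unordered pair, the logistic model is exact. *)
Definition pair_prob t (p : 'I_n * 'I_n) : R :=
  (compared t p.1 p.2)%:R * (a p.1 / Z t / (k - 1)%:R).
Definition pair_curv (p : 'I_n * 'I_n) : R := Logistic.lcurv (th p.1 - th p.2).
Definition pair_grad (p : 'I_n * 'I_n) : R := 1 - Logistic.sgm (th p.1 - th p.2).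

Let a_gt0 i : 0 < a i. Proof. exact: expR_gt0. Qed.
Let k1_gt0 : 0 < (k - 1)%:R :> R. Proof. by rewrite ltr0n subn_gt0. Qed.
Let k_gt0 : 0 < k%:R :> R. Proof. by rewrite ltr0n; apply: leq_trans k2. Qed.

Let Z_gt0 t : 0 < Z t.
Proof.
have [i iS] : exists i, i \in S t.
  by apply/card_gt0P; rewrite card_S; apply: leq_trans k2.
rewrite /Z (bigD1 i) //= ltr_pwDl //; apply: sumr_ge0 => j _; exact: ltW.
Qed.

Lemma sum_compared t (f : 'I_n -> R) :
  \sum_i \sum_j (compared t i j)%:R * f i = (k - 1)%:R * \sum_(i in S t) f i.
Proof.
rewrite [in RHS]big_mkcond mulr_sumr; apply: eq_bigr => i _.
rewrite -mulr_suml -natr_sum /compared; case: ifP => iS; last first.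
  by rewrite big1 ?mul0r ?mulr0.
congr (_%:R * _); rewrite /= -(card_S t) (cardsD1 i (S t)) iS addKn -sum1_card.
rewrite [RHS]big_mkcond; apply: eq_bigr => j _; rewrite in_setD1 andbC eq_sym.
by case: (_ && _).
Qed.

Lemma pair_prob_ge0 t p : 0 <= pair_prob t p.
Proof. by rewrite !mulr_ge0 ?invr_ge0 // ltW. Qed.

Lemma pair_prob_sum1 t : \sum_p pair_prob t p = 1.
Proof.
rewrite -(pair_big xpredT xpredT (fun i j => pair_prob t (i, j))) /= /pair_prob /=.
rewrite (sum_compared t (fun i => a i / Z t / (k - 1)%:R)) -!mulr_suml mulrC.
by rewrite mulfVK ?lt0r_neq0 // mulfV // (lt0r_neq0 (Z_gt0 t)).
Qed.

Let pair_gradE i j : pair_grad (i, j) = a j / (a i + a j).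
Proof.
rewrite /pair_grad /= sgm_sub; have ai := a_gt0 i; have aj := a_gt0 j.
rewrite -/(a i) -/(a j); field; by rewrite lt0r_neq0 ?addr_gt0.
Qed.

Let pair_curvE i j : pair_curv (i, j) = a i * a j / (a i + a j) ^+ 2.
Proof.
rewrite /pair_curv /Logistic.lcurv /= !RringE sgm_sub -/(a i) -/(a j).
have ai := a_gt0 i; have aj := a_gt0 j.
by field; rewrite lt0r_neq0 ?addr_gt0.
Qed.

Let compared_sym t i j : compared t i j = compared t j i.
Proof. by rewrite /compared andbCA eq_sym. Qed.

(** Both sides contain [a i * a j / (a i + a j)]. The difference vector changes sign with the order,
    so the score has mean zero. *)
Lemma pair_grad_prob_sym t i j :
  pair_prob t (i, j) * pair_grad (i, j) = pair_prob t (j, i) * pair_grad (j, i).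
Proof.
rewrite /pair_prob /= compared_sym !pair_gradE (addrC (a j)).
ring.
Qed.

(** The information identity, pair by pair: the squared score of one order matches the curvature of
    the other. *)
Lemma pair_grad_curv t i j :
  pair_prob t (i, j) * pair_grad (i, j) ^+ 2 = pair_prob t (j, i) * pair_curv (j, i).
Proof.
rewrite /pair_prob /= compared_sym !pair_gradE pair_curvE (addrC (a j)) expr_div_n; ring.
Qed.

Let a_ge i : exp (- b) <= a i.
Proof. by apply: expR_le; case/andP: (th_bnd i). Qed.

Let a_le i : a i <= exp b.
Proof. by apply: expR_le; case/andP: (th_bnd i). Qed.

(** Adding both orders leaves half the harmonic mean of [a i] and [a j], at least [e^(-b) / 2],
    divided by [Z <= k e^b]. Bounding probability and curvature separately would lose a further
    factor of order [e^(-2b)]. *)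
Lemma pair_curv_prob_ge t i j :
  (compared t i j)%:R * (exp (- (2 * b)) / (2 * k%:R * (k - 1)%:R)) <=
  pair_prob t (i, j) * pair_curv (i, j) + pair_prob t (j, i) * pair_curv (j, i).
Proof.
have ai := a_gt0 i; have aj := a_gt0 j; have z0 := Z_gt0 t.
have -> : pair_prob t (i, j) * pair_curv (i, j) + pair_prob t (j, i) * pair_curv (j, i) =
  (compared t i j)%:R * (a i * a j / (a i + a j) / Z t / (k - 1)%:R).
  rewrite /pair_prob /= (compared_sym t j i) !pair_curvE; field.
  by rewrite !lt0r_neq0 ?addr_gt0.
rewrite ler_wpM2l // invfM mulrA; apply: ler_wpM2r; first by rewrite invr_ge0 ltW.
have Zk : Z t <= k%:R * exp b.
  rewrite -(card_S t) mulr_natl -sumr_const; apply: ler_sum => *; exact: a_le.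
have h1 : exp (- b) / 2 <= a i * a j / (a i + a j).
  rewrite ler_pdivlMr ?addr_gt0 // mulrAC ler_pdivrMr //.
  have := a_ge i; have := a_ge j; have := expR_gt0 (- b).
  move: (exp _) (a i) (a j) ai aj => e x y x0 y0 e0 h1 h2; nra.
have eb := expR_gt0 b; have ebn := expR_gt0 (- b).
rewrite ler_pdivlMr //; apply: le_trans h1.
apply: le_trans (_ : exp (- (2 * b)) / (2 * k%:R) * (k%:R * exp b) <= _).
  by rewrite ler_wpM2l // mulr_ge0 ?invr_ge0 ?mulr_ge0 // ltW // expR_gt0.
have -> : exp (- (2 * b)) = exp (- b) / exp b by rewrite -expR_opp -expR_add; congr exp; ring.
rewrite le_eqVlt; apply/orP; left; apply/eqP; field.
by rewrite !lt0r_neq0.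
Qed.

Lemma sum_pair_swap (F : 'I_n * 'I_n -> R) :
  2 * \sum_p F p = \sum_i \sum_j (F (i, j) + F (j, i)).
Proof.
under [RHS]eq_bigr => i _ do rewrite big_split.
rewrite big_split /= [X in _ = _ + X]exchange_big /= pair_big /=.
by rewrite mulr_natl mulr2n; congr (_ + _); apply: eq_bigr => -[].
Qed.

Hypothesis m_gt0 : (0 < m)%N.
Hypothesis b_gt0 : 0 < b.
Hypothesis th_sum0 : \sum_i th i = 0.
Hypothesis d3 : (3 <= d)%N.
Variables (lam : R) (U : 'M[R]_(n, d)).
Hypothesis lam_gt0 : 0 < lam.
Hypothesis U_diff : forall i j, \sum_r (U i r - U j r) ^+ 2 <= 2.
Hypothesis U_span : forall v : 'I_n -> R, \sum_i v i = 0 ->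
  forall i, v i = \sum_r U i r * \sum_j U j r * v j.
Hypothesis U_quad : forall c : 'I_d -> R, lam * \sum_r c r ^+ 2 <=
  2^-1 * \sum_i \sum_j (n%:R / m%:R * \sum_t (compared t i j)%:R) *
     (\sum_r U i r * c r - \sum_r U j r * c r) ^+ 2.
Hypothesis lam_le : lam * d%:R <= n%:R * (k%:R * (k - 1)%:R).
Let x := lam / (k%:R * (k - 1)%:R).
Let h := exp (- (2 * b)) * m%:R * x / (2 * n%:R).
Hypothesis nontriv : 2 * exp (2 * b) * (ln n%:R + 2) <= x * b ^+ 2 * h.

Let z (p : 'I_n * 'I_n) : 'cV[R]_d := \col_r (U p.1 r - U p.2 r).

Let zE p (c : 'cV[R]_d) :
  \tr ((z p)^T *m c) = \sum_r U p.1 r * c r 0 - \sum_r U p.2 r * c r 0.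
Proof.
rewrite -[\tr _]/(frob _ _) frobE -sumrB; apply: eq_bigr => r _.
by rewrite big_ord1 mxE mulrBl.
Qed.

Let quadE (w : 'I_m -> 'I_n * 'I_n -> R) (c : 'cV[R]_d) :
  \tr (c^T *m (\sum_t \sum_p w t p *: (z p *m (z p)^T)) *m c) =
  \sum_t \sum_p w t p * \tr ((z p)^T *m c) ^+ 2.
Proof.
rewrite mulmx_sumr mulmx_suml raddf_sum; apply: eq_bigr => t _ /=.
rewrite mulmx_sumr mulmx_suml raddf_sum; apply: eq_bigr => p _ /=.
rewrite -scalemxAr -scalemxAl mxtraceZ; congr (_ * _).
have -> : c^T *m (z p *m (z p)^T) *m c = ((z p)^T *m c)^T *m ((z p)^T *m c).
  by rewrite trmx_mul trmxK !mulmxA.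
by rewrite !mxtrace11 mxE big_ord1 expr2 [(_^T) 0 0]mxE.
Qed.

Let zanti i j r : z (j, i) r 0 = - z (i, j) r 0.
Proof. by rewrite !mxE opprB. Qed.

Let kk_gt0 : 0 < k%:R * (k - 1)%:R :> R. Proof. exact: mulr_gt0. Qed.
Let x_gt0 : 0 < x. Proof. by rewrite divr_gt0. Qed.
Let n_gt0 : 0 < n%:R :> R. Proof. by rewrite ltr0n. Qed.
Let mR_gt0 : 0 < m%:R :> R. Proof. by rewrite ltr0n. Qed.
Let h_gt0 : 0 < h.
Proof.
apply: divr_gt0; last exact: mulr_gt0.
by apply: mulr_gt0 => //; apply: mulr_gt0 => //; apply: expR_gt0.
Qed.

(** The pairwise bound, summed, is the quadratic form of the Laplacian times
    [e^(-2b) m / (2k(k-1)n)]; with [lam] this is [h]. *)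
Let curvature_ge (v : 'cV[R]_d) : h * \tr (v^T *m v) <=
  \tr (v^T *m (\sum_t \sum_p (pair_prob t p * pair_curv p) *: (z p *m (z p)^T)) *m v).
Proof.
rewrite quadE; pose D i j := \sum_r U i r * v r 0 - \sum_r U j r * v r 0.
pose c0 := exp (- (2 * b)) / (2 * k%:R * (k - 1)%:R).
have c00 : 0 < c0 by rewrite divr_gt0 ?expR_gt0 // mulr_gt0 // mulr_gt0.
have nv : \tr (v^T *m v) = \sum_r v r 0 ^+ 2.
  by rewrite -[\tr _]/(frob v v) frobE; apply: eq_bigr => r _; rewrite big_ord1 expr2.
apply: le_trans (_ : c0 * (m%:R / n%:R) * (lam * \sum_r v r 0 ^+ 2) <= _).
  rewrite nv le_eqVlt; apply/orP; left; apply/eqP; rewrite /h /x /c0; field.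
  by rewrite !lt0r_neq0.
have c1 : 0 <= c0 * (m%:R / n%:R) by apply/ltW/mulr_gt0 => //; apply: divr_gt0.
apply: le_trans (ler_wpM2l c1 (U_quad (fun r => v r 0))) _.
rewrite -(ler_pM2l (ltr0Sn R 1)).
have -> : 2 * (c0 * (m%:R / n%:R) * (2^-1 * \sum_i \sum_j (n%:R / m%:R *
    \sum_t (compared t i j)%:R) * (\sum_r U i r * v r 0 - \sum_r U j r * v r 0) ^+ 2)) =
  \sum_t \sum_i \sum_j (compared t i j)%:R * c0 * D i j ^+ 2.
  transitivity (c0 * (m%:R / n%:R) * \sum_i \sum_j (n%:R / m%:R *
    \sum_t (compared t i j)%:R) * D i j ^+ 2).
    by rewrite /D; field; rewrite lt0r_neq0.
  rewrite [RHS]exchange_big mulr_sumr; apply: eq_bigr => i _ /=.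
  rewrite [RHS]exchange_big mulr_sumr; apply: eq_bigr => j _ /=.
  rewrite -!mulr_suml; field; by rewrite !lt0r_neq0.
rewrite mulr_sumr; apply: ler_sum => t _; rewrite sum_pair_swap.
apply: ler_sum => i _; apply: ler_sum => j _.
have Dsq : D j i ^+ 2 = D i j ^+ 2 by rewrite /D; ring.
rewrite !zE /= -/(D i j) -/(D j i) Dsq -mulrDl.
by apply: ler_wpM2r; [exact: sqr_ge0|exact: pair_curv_prob_ge].
Qed.

(** [th'] stands for an estimator; quantifying it existentially for each outcome makes the bound
    uniform over all maximisers. *)
Lemma luce_bad_prob (bad : {ffun 'I_m -> 'I_n * 'I_n} -> bool) :
  (forall w, bad w -> exists th' : 'I_n -> R,
    [/\ forall i, - b <= th' i <= b, \sum_i th' i = 0,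
        \sum_t Logistic.lgs (th' (w t).1 - th' (w t).2) <=
        \sum_t Logistic.lgs (th (w t).1 - th (w t).2) &
        16 * n%:R ^+ 2 * exp (2 * b) ^+ 2 * (ln n%:R + 2) / (x ^+ 2 * m%:R)
        < \sum_i (th' i - th i) ^+ 2]) ->
  expect pair_prob (fun w => (bad w)%:R) <= 3 / n%:R.
Proof.
move=> hbad.
have xd : x * d%:R <= n%:R.
  by rewrite /x mulrAC ler_pdivrMr.
have [s [q [s0 s1 es eq6 fin]]] := tail_parametersE d3 b_gt0 x_gt0 h_gt0 xd nontriv.
have L0 : 0 < ln n%:R + 2.
  have : 0 < x / (ln n%:R + 2).
    have e2 : 0 < (1 + b) ^+ 2 * exp (- (2 * b)).
      by rewrite mulr_gt0 ?expR_gt0 // exprn_gt0 // addr_gt0.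
    by rewrite -(pmulr_rgt0 _ e2) -es exprn_gt0.
  by rewrite pmulr_rgt0 // invr_gt0.
have sg p := Logistic.sgm_bounds (th p.1 - th p.2).
have tail := @quadratic_domination_tail _ _ m d pair_prob pair_prob_ge0 pair_prob_sum1
  (fun _ => z) (fun _ => pair_curv) (fun _ => pair_grad) h.
apply: le_trans fin.
(* This selects [T = 2n], so that [T - d = n + 1] in the Chebyshev term. *)
have -> : d.+1%:R + 1 = 2 * n%:R - d%:R :> R by rewrite /n -natr1; ring.
apply: (tail _ _ _ _ _ _ _ _ bad (2 + 2 * b)) => //.
- move=> _ p; rewrite -[\tr _]/(frob _ _) frobE; apply: le_trans (U_diff p.1 p.2).
  by apply: ler_sum => r _; rewrite big_ord1 !mxE expr2.
- by move=> _ p; apply/ltW/RltP/Logistic.lcurv_pos.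
- move=> _ p; rewrite /pair_curv /Logistic.lcurv !RringE.
  have := sqr_ge0 (2 * Logistic.sgm (th p.1 - th p.2) - 1); lra.
- move=> _ p; have [/RltP h1 /RltP h2] := sg p.
  rewrite /pair_grad expr2; move: h1 h2; rewrite !RringE => h1 h2; nra.
- move=> t r; apply/eqP; rewrite -(mulrI_eq0 _ (mulfI (lt0r_neq0 (ltr0Sn R 1)))).
  rewrite sum_pair_swap big1 // => i _; rewrite big1 // => j _.
  by rewrite (zanti i j) !mulrA (pair_grad_prob_sym t j i) mulrN subrr.
- apply: eq_bigr => t _; apply/matrixP => r r'; rewrite !summxE.
  rewrite -(pair_big xpredT xpredT (fun i j =>
    ((pair_prob t (i, j) * pair_grad (i, j) ^+ 2) *: (z (i, j) *m (z (i, j))^T)) r r')) /=.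
  rewrite -(pair_big xpredT xpredT (fun i j =>
    ((pair_prob t (i, j) * pair_curv (i, j)) *: (z (i, j) *m (z (i, j))^T)) r r')) /=.
  rewrite exchange_big; apply: eq_bigr => i _; apply: eq_bigr => j _ /=.
  rewrite pair_grad_curv !mxE !big_ord1 !mxE; ring.
- by rewrite /n -natr1; have := ler0n R d; lra.
- by move: eq6; rewrite -!natr1 -mul2n natrM => eq6; lra.
- by rewrite addr_ge0 // mulr_ge0 // ltW.
move=> w /hbad [th' [th'b th'0 lik far]].
pose dl i := th' i - th i.
have dl0 : \sum_i dl i = 0 by rewrite sumrB th'0 th_sum0 subrr.
(* Coordinates of the error in the basis [U]; nothing is lost, as the error sums to zero. *)
pose c : 'cV[R]_d := \col_r \sum_j U j r * dl j.
have zc p : \tr ((z p)^T *m c) = dl p.1 - dl p.2.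
  rewrite zE (U_span dl0 p.1) (U_span dl0 p.2).
  by congr (_ - _); apply: eq_bigr => r _; rewrite mxE.
exists c; split.
  pose D t := th (w t).1 - th (w t).2; pose e t := dl (w t).1 - dl (w t).2.
  have rng (f : 'I_n -> R) i j : (forall i, - b <= f i <= b) ->
     - (2 * b) <= f i - f j /\ f i - f j <= 2 * b.
    by move=> fb; have /andP[? ?] := fb i; have /andP[? ?] := fb j; split; lra.
  have step t : pair_curv (w t) * e t ^+ 2 <= (2 + 2 * b) *
      (Logistic.lgs (th' (w t).1 - th' (w t).2) - Logistic.lgs (D t) + pair_grad (w t) * e t).
    have [/RleP r1 /RleP r2] := rng th (w t).1 (w t).2 th_bnd.
    have [/RleP r3 /RleP r4] := rng th' (w t).1 (w t).2 th'b.
    have De : D t + e t = th' (w t).1 - th' (w t).2 by rewrite /D /e /dl; ring.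
    rewrite -De in r3 r4 *.
    have /RleP := Logistic.lbreg_quadratic (2 * b) (D t) (e t) (conj r1 r2) (conj r3 r4).
    rewrite /Logistic.lbreg !RringE.
    rewrite mulrA ler_pdivrMr ?addr_gt0 ?mulr_gt0 // => hq.
    by rewrite [leRHS]mulrC; exact: hq.
  apply: le_trans (_ : \sum_t (2 + 2 * b) *
      (Logistic.lgs (th' (w t).1 - th' (w t).2) - Logistic.lgs (D t) + pair_grad (w t) * e t) <= _).
    by apply: ler_sum => t _; rewrite zc; exact: step.
  rewrite -mulr_sumr; apply: ler_wpM2l; first by rewrite addr_ge0 // mulr_ge0 // ltW.
  rewrite big_split sumrB /=.
  under [leRHS]eq_bigr => t _ do rewrite zc.
  by rewrite -subr_le0 in lik; rewrite -[leRHS]add0r; apply: lerD.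
have -> : \tr (c^T *m c) = \sum_i dl i ^+ 2.
  rewrite -[\tr _]/(frob c c) frobE.
  transitivity (\sum_i dl i * \sum_r U i r * c r 0).
    under [RHS]eq_bigr => i _ do rewrite mulr_sumr.
    rewrite [RHS]exchange_big; apply: eq_bigr => r _ /=; rewrite big_ord1.
    rewrite {1}[c r 0]mxE mulr_suml; apply: eq_bigr => i _; ring.
  apply: eq_bigr => i _; rewrite expr2; congr (_ * _); rewrite [RHS](U_span dl0 i).
  by apply: eq_bigr => r _; rewrite mxE.
(* The identity between [K^2 T / (s^2 h)] and the claimed bound, which determined [s]. *)
apply: le_lt_trans far; rewrite es /h le_eqVlt; apply/orP; left; apply/eqP.
rewrite !expR_opp; have := expR_gt0 (2 * b); move: (exp (2 * b)) => E E0.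
have b1 : 0 < 1 + b by apply: addr_gt0.
by field; rewrite !lt0r_neq0.
Qed.

End LuceCore.

(** * From lists of pairs to finite functions *)

Lemma InE (x : nat) l : List.In x l <-> x \in l.
Proof.
elim: l => [|y l ih] //=; rewrite in_cons; split.
  by case=> [->|/ih ->]; rewrite ?eqxx ?orbT.
by case/orP=> [/eqP ->|/ih]; [left|right].
Qed.

Lemma NoDupE (l : seq nat) : List.NoDup l -> uniq l.
Proof.
by elim=> [|x s nx _ ih] //=; rewrite ih andbT; apply/negP => /InE.
Qed.

Lemma membE i l : memb i l = (i \in l).
Proof. by elim: l => [|y l ih] //=; rewrite in_cons -ih -eqbE. Qed.

Lemma List_nthE (A : Type) (x : A) l i : List.nth i l x = nth x l i.
Proof. by elim: l i => [|y l ih] [|i] //=. Qed.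

Lemma prodL_ord n (f : nat -> R) : prodL (List.seq 0 n) f = \prod_(i < n) f i.
Proof.
have prodLE (A : Type) (l : seq A) (g : A -> R) : prodL l g = \prod_(x <- l) g x.
  by elim: l => [|x l ih]; rewrite ?big_nil // big_cons -ih.
by rewrite prodLE seqE -[n in iota 0 n]subn0 big_mkord.
Qed.

Lemma sum_flat_map (A B : Type) (F : A -> seq B) l (g : B -> R) :
  \sum_(x <- List.flat_map F l) g x = \sum_(i <- l) \sum_(x <- F i) g x.
Proof.
elim: l => [|y l ih] /=; first by rewrite !big_nil.
by rewrite big_cons -ih -big_cat.
Qed.

Lemma sum_List_map (A B : Type) (F : A -> B) l (g : B -> R) :
  \sum_(x <- List.map F l) g x = \sum_(i <- l) g (F i).
Proof. by elim: l => [|y l ih] /=; rewrite ?big_nil // !big_cons ih. Qed.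

Lemma sum_List_filter (A : Type) (P : pred A) l (g : A -> R) :
  \sum_(x <- List.filter P l) g x = \sum_(x <- l | P x) g x.
Proof.
elim: l => [|y l ih] /=; first by rewrite !big_nil.
by rewrite [RHS]big_cons -ih; case: (P y); rewrite ?big_cons.
Qed.

Lemma sum_seq_ord n (l : seq nat) (P : pred nat) (f : nat -> R) :
  uniq l -> {in l, forall x, (x < n)%N} ->
  \sum_(x <- l | P x) f x = \sum_(i < n) ((val i \in l) && P i)%:R * f i.
Proof.
move=> ul ln.
have pl : perm_eq l [seq val i | i <- enum 'I_n & val i \in l].
  apply: uniq_perm => //.
    by rewrite (map_inj_uniq val_inj) filter_uniq // enum_uniq.
  move=> x; apply/idP/mapP => [xl|[i]]; last by rewrite mem_filter => /andP[? _] ->.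
  by exists (Ordinal (ln x xl)) => //; rewrite mem_filter xl mem_enum.
rewrite (perm_big _ pl) big_map big_filter_cond big_enum_cond big_mkcond /=.
by apply: eq_bigr => i _; case: ifP => _; rewrite ?mul1r ?mul0r.
Qed.

Section Bridge.
Variables (d m k : nat) (Sc : nat -> seq nat) (th : nat -> R).
Let n := d.+1.
Hypothesis k2 : (2 <= k)%N.
Hypothesis Sc_uniq : forall t, (t < m)%N -> uniq (Sc t).
Hypothesis Sc_size : forall t, (t < m)%N -> size (Sc t) = k.
Hypothesis Sc_lt : forall t, (t < m)%N -> {in Sc t, forall x, (x < n)%N}.

Definition comp_set (t : 'I_m) : {set 'I_n} := [set i | val i \in Sc t].
Let tho (i : 'I_n) := th i.

Lemma card_comp_set t : #|comp_set t| = k.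
Proof.
apply/eqP; rewrite -(eqr_nat R) -(Sc_size (ltn_ord t)) -sum1_card -sum1_size !natr_sum.
rewrite (sum_seq_ord xpredT (fun=> 1) (Sc_uniq (ltn_ord t)) (Sc_lt (ltn_ord t))).
rewrite big_mkcond; apply/eqP; apply: eq_bigr => i _.
by rewrite inE andbT; case: ifP; rewrite ?mulr1.
Qed.

Definition outcome_of c (w : {ffun 'I_c -> 'I_n * 'I_n}) : outcome :=
  [seq (val (w t).1, val (w t).2) | t <- enum 'I_c].

Lemma nth_outcome_of c (w : {ffun 'I_c -> 'I_n * 'I_n}) (t : 'I_c) :
  List.nth t (outcome_of w) (0%N, 0%N) = (val (w t).1, val (w t).2).
Proof.
by rewrite List_nthE (nth_map t) ?size_enum_ord // nth_ord_enum.
Qed.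

Lemma outcome_of_fcons c p (w : {ffun 'I_c -> 'I_n * 'I_n}) :
  outcome_of (fcons p w) = (val p.1, val p.2) :: outcome_of w.
Proof.
rewrite /outcome_of enum_ordSl /= fcons0 -map_comp; congr (_ :: _).
by apply: eq_map => t /=; rewrite fconsS.
Qed.

Let okl (l : seq nat) (p : 'I_n * 'I_n) :=
  [&& val p.1 \in l, val p.2 \in l & p.1 != p.2].

Lemma sumL_pairs l g : uniq l -> {in l, forall x, (x < n)%N} ->
  sumL (pairs l) g = \sum_p (okl l p)%:R * g (val p.1, val p.2).
Proof.
move=> ul ln; rewrite sumLE /pairs sum_flat_map (sum_seq_ord xpredT _ ul ln).
rewrite -(pair_big xpredT xpredT (fun i j => (okl l (i, j))%:R * g (val i, val j))) /=.
apply: eq_bigr => i _; rewrite sum_List_map sum_List_filter.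
rewrite (sum_seq_ord _ (fun j => g (val i, j)) ul ln) mulr_sumr andbT.
apply: eq_bigr => j _; rewrite mulrA -natrM mulnb /okl /= eqbE eq_sym.
by rewrite (inj_eq val_inj).
Qed.

(** With indicator weights [expect] is a plain sum over admissible outcomes; the actual
    probabilities are multiplied in afterwards. The offset [t0] serves the recursion of [outs]. *)
Lemma sumL_outs c t0 f : (t0 + c <= m)%N ->
  sumL (outs Sc t0 c) f =
  expect (fun (t : 'I_c) p => (okl (Sc (t0 + t)%N) p)%:R) (fun w => f (outcome_of w)).
Proof.
elim: c t0 f => [|c ih] t0 f t0c.
  rewrite /= /expect (eq_bigr (fun=> f [::])) => [|w _]; last first.
    rewrite big_ord0 mul1r; congr f; apply: size0nil; by rewrite size_map size_enum_ord.
  by rewrite sumr_const card_ffun card_ord expn0 mulr1n; exact: addr0.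
have t0m : (t0 < m)%N by apply: leq_trans t0c; rewrite addnS ltnS leq_addr.
pose g p := sumL (outs Sc t0.+1 c) (fun o => f (p :: o)).
transitivity (sumL (pairs (Sc t0)) g).
  rewrite /= !sumLE sum_flat_map; apply: eq_bigr => p _.
  by rewrite sum_List_map -sumLE.
rewrite (sumL_pairs _ (Sc_uniq t0m) (Sc_lt t0m)) expect_recl addn0.
apply: eq_bigr => p _; congr (_ * _); rewrite /g ih ?addSnnS //.
rewrite /expect; apply: eq_bigr => w _; rewrite outcome_of_fcons; congr (_ * _).
by apply: eq_bigr => t _; rewrite /= /bump /= add1n addSnnS.
Qed.

Lemma sumL_comp_set (t : 'I_m) (f : nat -> R) :
  sumL (Sc t) f = \sum_(i in comp_set t) f i.
Proof.
rewrite sumLE (sum_seq_ord xpredT f (Sc_uniq (ltn_ord t)) (Sc_lt (ltn_ord t))).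
rewrite [RHS]big_mkcond; apply: eq_bigr => i _.
by rewrite inE andbT; case: ifP; rewrite ?mul1r ?mul0r.
Qed.

Lemma probE E : prob m k Sc th E =
  expect (pair_prob k comp_set tho) (fun w => indic (E (outcome_of w))).
Proof.
rewrite /prob sumL_outs //; apply: eq_bigr => w _; rewrite mulrA; congr (_ * _).
rewrite /weight prodL_ord -big_split; apply: eq_bigr => t _ /=.
rewrite nth_outcome_of /= /pair_prob /compared /okl !inE add0n /luce sumL_comp_set.
by rewrite !RringE.
Qed.

Lemma indic_ge0 P : 0 <= indic P.
Proof. by rewrite /indic; case: ClassicalEpsilon.excluded_middle_informative => _. Qed.

Lemma prob_ge0 E : 0 <= prob m k Sc th E.
Proof.
rewrite probE /expect; apply: sumr_ge0 => w _; rewrite mulr_ge0 ?indic_ge0 //.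
apply: prodr_ge0 => t _; exact: pair_prob_ge0 k2 card_comp_set _ _.
Qed.

Lemma prob_true (E : outcome -> Prop) : (forall o, E o) -> prob m k Sc th E = 1.
Proof.
move=> Et; rewrite probE (eq_expect _ (G := fun=> 1)) => [|w]; last first.
  by rewrite /indic; case: ClassicalEpsilon.excluded_middle_informative.
by apply: expect_cst => t; exact: pair_prob_sum1 k2 card_comp_set t.
Qed.

(** The event quantifies over real parameters, so its complement becomes a boolean by excluded
    middle. *)
Lemma prob_ge_of_bad (E : outcome -> Prop) (eps : R) :
  (forall bad : {ffun 'I_m -> 'I_n * 'I_n} -> bool,
    (forall w, bad w -> ~ E (outcome_of w)) ->
    expect (pair_prob k comp_set tho) (fun w => (bad w)%:R) <= eps) ->
  1 - eps <= prob m k Sc th E.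
Proof.
pose bad (w : {ffun 'I_m -> 'I_n * 'I_n}) : bool := if ClassicalEpsilon.excluded_middle_informative (E (outcome_of w)) then false else true.
move=> /(_ bad) hb; rewrite probE.
have -> : expect (pair_prob k comp_set tho) (fun w => indic (E (outcome_of w))) =
   1 - expect (pair_prob k comp_set tho) (fun w => (bad w)%:R).
  rewrite -mulN1r -expectZ.
  rewrite -[X in X + _](expect_cst (pair_prob_sum1 tho k2 card_comp_set)) -expectD.
  apply: eq_expect => w; rewrite /indic /bad.
  by case: ClassicalEpsilon.excluded_middle_informative => _ /=; rewrite ?R1E ?R0E; ring.
rewrite lerD2l lerN2; apply: hb => w; rewrite /bad.
by case: ClassicalEpsilon.excluded_middle_informative.
Qed.

Lemma MmatE (i j : 'I_n) :
  Mmat n m Sc i j = n%:R / m%:R * \sum_t (compared comp_set t i j)%:R.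
Proof.
rewrite /Mmat eqbE (inj_eq val_inj); case: eqP => [->|/eqP ne].
  by rewrite big1 ?mulr0 // => t _; rewrite /compared eqxx !andbF.
rewrite !RringE; congr (_ * _).
have -> l : length l = size l by [].
rewrite -sum1_size natr_sum sum_List_filter seqE -[m in iota 0 m]subn0 big_mkord.
rewrite big_mkcond; apply: eq_bigr => t _ /=.
by rewrite !membE /compared !inE ne andbT; case: ifP.
Qed.

End Bridge.

Lemma lambda2_basis (d m : nat) (Sc : nat -> seq nat) (lam : R) : (0 < d)%N ->
  is_lambda2 d.+1 (laplacian d.+1 (Mmat d.+1 m Sc)) lam -> 0 < lam ->
  let M (i j : 'I_d.+1) := Mmat d.+1 m Sc i j in
  (forall i j, M i j = M j i) -> (forall i j, 0 <= M i j) ->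
  exists U : 'M[R]_(d.+1, d),
  [/\ forall i j, \sum_r (U i r - U j r) ^+ 2 <= 2,
      forall v : 'I_d.+1 -> R, \sum_i v i = 0 ->
        forall i, v i = \sum_r U i r * \sum_j U j r * v j,
      forall c : 'I_d -> R, lam * \sum_r c r ^+ 2 <=
        2^-1 * \sum_i \sum_j M i j * (\sum_r U i r * c r - \sum_r U j r * c r) ^+ 2 &
      lam * d%:R <= \sum_i \sum_j M i j - \sum_i M i i].
Proof.
move=> d0 [mu [V [orth [eig [incr ->]]]]] lam0 M Msym M0.
have ltP (i : 'I_d.+1) : (i < d.+1)%coq_nat by apply/ssrnat.ltP.
have e1 : 1%N = val (inord 1 : 'I_d.+1) by rewrite /= inordK.
have [||||U] := @laplacian_basis R d M Msym M0 (fun i => mu i)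
   (\matrix_(i, j) V i j).
- apply/matrixP => i j; rewrite !mxE; have := orth i j (ltP i) (ltP j).
  rewrite sumL_ord eqbE (inj_eq val_inj) => e.
  transitivity (\sum_(r < d.+1) Rdefinitions.Rmult (V r i) (V r j)).
    by apply: eq_bigr => r _; rewrite !mxE.
  by rewrite e; case: (i == j).
- move=> i r; have := eig i r (ltP i) (ltP r).
  rewrite sumL_ord mxE !RringE => <-; apply: eq_bigr => c _; rewrite mxE.
  rewrite /laplacian !RringE eqbE (inj_eq val_inj); congr (_ * _); congr (_ - _).
  by case: eqP => // _; rewrite sumL_ord.
- move=> i i0; apply/RleP; apply: incr; last exact: ltP.
  by rewrite -e1; apply/ssrnat.leP; rewrite lt0n.
- by rewrite -e1.
by rewrite -e1 => h; exists U.
Qed.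

Lemma ln_luce2 (x y : R) :
  ln (Rdefinitions.Rdiv (exp x) (Rdefinitions.Rplus (exp x) (exp y))) = - Logistic.lgs (x - y).
Proof.
rewrite /Logistic.lgs -[RHS](Rpower.ln_Rinv (1 + exp (- (x - y)))); last first.
  by apply/RltP; rewrite addr_gt0 ?expR_gt0.
congr ln; rewrite !RringE opprB expR_add expR_opp.
by field; rewrite !lt0r_neq0 ?addr_gt0 ?expR_gt0.
Qed.

Lemma ell1E (d m : nat) (w : {ffun 'I_m -> 'I_d.+1 * 'I_d.+1}) (th : nat -> R) :
  ell1 m (outcome_of w) th = - \sum_t Logistic.lgs (th (w t).1 - th (w t).2).
Proof.
rewrite /ell1 sumL_ord -sumrN; apply: eq_bigr => t _.
by rewrite nth_outcome_of ln_luce2.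
Qed.

(** * The error bound for the estimator *)

Section MainBound.
Variables (d m k : nat) (b : R) (Sc : nat -> seq nat) (thstar : nat -> R).
Hypothesis k2 : (2 <= k)%N.
Hypothesis m0 : (0 < m)%N.
Hypothesis HSc : forall t, (t < m)%coq_nat ->
  List.NoDup (Sc t) /\ length (Sc t) = k /\ (forall i, List.In i (Sc t) -> (i < d.+1)%coq_nat).

Let Sc_uniq t : (t < m)%N -> uniq (Sc t).
Proof. by move=> /ssrnat.ltP /HSc[/NoDupE]. Qed.

Let Sc_size t : (t < m)%N -> size (Sc t) = k.
Proof. by move=> /ssrnat.ltP /HSc[_ []]. Qed.

Let Sc_lt t : (t < m)%N -> {in Sc t, forall x, (x < d.+1)%N}.
Proof. by move=> /ssrnat.ltP /HSc[_ [_ h]] x /InE /h /ssrnat.ltP. Qed.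

Lemma luce_prob_ge0 E : Rdefinitions.Rle (Rdefinitions.IZR BinNums.Z0) (prob m k Sc thstar E).
Proof. by apply/RleP; exact: (prob_ge0 thstar k2 Sc_uniq Sc_size Sc_lt). Qed.

Lemma luce_prob_true (E : outcome -> Prop) : (forall o, E o) -> prob m k Sc thstar E = 1.
Proof. exact: (prob_true thstar k2 Sc_uniq Sc_size Sc_lt). Qed.

Lemma in_ThetaE th : in_Theta d.+1 b th ->
  (forall i : 'I_d.+1, - b <= th i <= b) /\ \sum_(i < d.+1) th i = 0.
Proof.
move=> [bnd]; rewrite sumL_ord => s0; split=> // i.
have /bnd[/RleP h1 /RleP h2] : (i < d.+1)%coq_nat by apply/ssrnat.ltP.
by apply/andP.
Qed.

Lemma luce_mle_prob (lam Bd : R) : (3 <= d)%N ->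
  in_Theta d.+1 b thstar ->
  is_lambda2 d.+1 (laplacian d.+1 (Mmat d.+1 m Sc)) lam ->
  0 < lam -> 0 < b ->
  let x := lam / (k%:R * (k - 1)%:R) in
  2 * exp (2 * b) * (ln d.+1%:R + 2) <=
    x * b ^+ 2 * (exp (- (2 * b)) * m%:R * x / (2 * d.+1%:R)) ->
  16 * d.+1%:R * exp (2 * b) ^+ 2 * (ln d.+1%:R + 2) / (x ^+ 2 * m%:R) <= Bd ->
  1 - 3 / d.+1%:R <= prob m k Sc thstar (fun o => forall th,
    is_argmax d.+1 b (ell1 m o) th -> Rdefinitions.Rle (mse d.+1 th thstar) Bd).
Proof.
move=> d3 /[dup] inT /in_ThetaE[th_bnd th_sum] lam2 lam0 b0 x nontriv HBd.
have d0 : (0 < d)%N by apply: leq_trans d3.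
pose S := comp_set d (m := m) Sc.
have ME (i j : 'I_d.+1) : Mmat d.+1 m Sc i j =
   d.+1%:R / m%:R * \sum_t (compared S t i j)%:R := MmatE m Sc i j.
have cardS := card_comp_set Sc_uniq Sc_size Sc_lt.
have coef0 : 0 <= d.+1%:R / m%:R :> R by rewrite divr_ge0.
have [||U [U1 U2 U3 U4]] := lambda2_basis d0 lam2 lam0.
- move=> i j; rewrite !ME; congr (_ * _); apply: eq_bigr => t _.
  by rewrite /compared andbCA eq_sym.
- by move=> i j; rewrite ME mulr_ge0 // sumr_ge0.
apply: (prob_ge_of_bad k2 Sc_uniq Sc_size Sc_lt) => bad hbad.
apply: (luce_bad_prob k2 cardS th_bnd m0 b0 th_sum d3 lam0 U1 U2) => //.
- move=> c; apply: le_trans (U3 c) _; rewrite le_eqVlt; apply/orP; left; apply/eqP.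
  congr (_ * _); apply: eq_bigr => i _; apply: eq_bigr => j _; by rewrite ME.
- apply: le_trans U4 _; rewrite [X in _ - X]big1 ?subr0 => [|i _]; last first.
    by rewrite ME big1 ?mulr0 // => t _; rewrite /compared eqxx !andbF.
  under eq_bigr => i _ do under eq_bigr => j _ do rewrite ME.
  under eq_bigr => i _ do rewrite -mulr_sumr exchange_big.
  rewrite -mulr_sumr exchange_big /=.
  (* Each comparison set contains [k (k - 1)] ordered pairs, so the trace of the Laplacian is
     [n k (k - 1)]. *)
  have e t : \sum_i \sum_j (compared S t i j)%:R = k%:R * (k - 1)%:R :> R.
    transitivity (\sum_i \sum_j (compared S t i j)%:R * (1 : R)).
      by apply: eq_bigr => i _; apply: eq_bigr => j _; rewrite mulr1.
    by rewrite (sum_compared cardS t (fun=> 1)) sumr_const cardS mulrC.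
  rewrite (eq_bigr _ (fun t _ => e t)) sumr_const card_ord -mulr_natr.
  rewrite le_eqVlt; apply/orP; left; apply/eqP; field.
  by rewrite pnatr_eq0 -lt0n.
(* Outside the event some maximiser is far away; [thstar] lies in the box and serves as its
   competitor. *)
move=> w /hbad nE.
have [th nth] := Classical_Pred_Type.not_all_ex_not _ _ nE.
have [[inT' best] far] := Classical_Prop.imply_to_and _ _ nth.
have [th'b th'0] := in_ThetaE inT'.
exists (fun i => th i); split=> //.
  have /RleP := best thstar inT; rewrite !ell1E => h.
  by rewrite -lerN2.
have far2 : Bd < mse d.+1 th thstar.
  by rewrite ltNge; apply/negP => /RleP.
have mseE : mse d.+1 th thstar = (\sum_(i < d.+1) (th i - thstar i) ^+ 2) / d.+1%:R.
  rewrite /mse sumL_ord !RringE mulrC; congr (_ * _).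
  by apply: eq_bigr => i _; rewrite !RringE.
have := le_lt_trans HBd far2; rewrite mseE ltr_pdivlMr ?ltr0n // => h; apply: le_lt_trans h.
rewrite le_eqVlt; apply/orP; left; apply/eqP; rewrite /x expr2; field.
have k1 : (k - 1)%:R != 0 :> R by rewrite pnatr_eq0 -lt0n subn_gt0.
have k0 : k%:R != 0 :> R by rewrite pnatr_eq0 -lt0n ltnW.
have mm : m%:R != 0 :> R by rewrite pnatr_eq0 -lt0n.
by rewrite k0 k1 mm (lt0r_neq0 lam0).
Qed.

End MainBound.

Lemma IZR16E :
  Rdefinitions.IZR (BinNums.Zpos (BinNums.xO (BinNums.xO (BinNums.xO (BinNums.xO BinNums.xH))))) = 16 :> R.
Proof. by rewrite IZRposE INRE. Qed.

Import Rdefinitions Raxioms Rpow_def.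
Local Open Scope R_scope.

Lemma luce_mle_probR (d m k : nat) (b : R) (Sc : nat -> list nat) (thstar : nat -> R)
    (lam Bd : R) : Peano.le 2 k -> Peano.lt 0 m -> Peano.le 3 d ->
  (forall t, Peano.lt t m -> List.NoDup (Sc t) /\ length (Sc t) = k /\
     (forall i, List.In i (Sc t) -> Peano.lt i d.+1)) ->
  in_Theta d.+1 b thstar ->
  is_lambda2 d.+1 (laplacian d.+1 (Mmat d.+1 m Sc)) lam ->
  Rlt 0 lam -> Rlt 0 b ->
  let x := lam / (INR k * INR (Nat.sub k 1)) in
  Rle (2 * exp (2 * b) * (ln (INR d.+1) + 2))
      (x * pow b 2 * (exp (- (2 * b)) * INR m * x / (2 * INR d.+1))) ->
  Rle (16 * INR d.+1 * pow (exp (2 * b)) 2 * (ln (INR d.+1) + 2) / (pow x 2 * INR m)) Bd ->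
  Rle (1 - 3 / INR d.+1) (prob m k Sc thstar (fun o => forall th,
    is_argmax d.+1 b (ell1 m o) th -> Rle (mse d.+1 th thstar) Bd)).
Proof.
move=> /ssrnat.leP k2 /ssrnat.ltP m0 /ssrnat.leP d3 HSc inT lam2 /RltP lam0 /RltP b0 x.
move=> /RleP nontriv /RleP HBd; apply/RleP.
have := @luce_mle_prob d m k b Sc thstar k2 m0 HSc lam Bd d3 inT lam2 lam0 b0.
move: nontriv HBd; rewrite /x !RringE IZR16E => nontriv HBd; exact.
Qed.

End Concentration.

(* Degenerate cases and conclusion *)
From Stdlib Require Import Reals List Lra Lia.
Open Scope R_scope.

Lemma sumL_le_const {A : Type} (l : list A) (f : A -> R) (c : R) :
  (forall a, In a l -> f a <= c) -> sumL l f <= INR (length l) * c.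
Proof.
  induction l as [|a l IH]; intros H.
  - simpl. lra.
  - change (sumL (a :: l) f) with (f a + sumL l f).
    change (length (a :: l)) with (S (length l)). rewrite S_INR.
    pose proof (H a (or_introl eq_refl)).
    pose proof (IH (fun x Hx => H x (or_intror Hx))). lra.
Qed.

Lemma mse_le_box (n : nat) (b : R) (th th' : nat -> R) : (0 < n)%nat ->
  in_Theta n b th -> in_Theta n b th' -> mse n th th' <= 4 * b ^ 2.
Proof.
  intros Hn [H1 _] [H2 _]. unfold mse.
  assert (Hn' : 0 < INR n) by (apply lt_0_INR; lia).
  apply Rmult_le_reg_l with (INR n); [exact Hn'|].
  rewrite <- Rmult_assoc, Rinv_r, Rmult_1_l by lra.
  rewrite <- (length_seq n 0) at 2. apply sumL_le_const.
  intros i Hi. apply in_seq in Hi.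
  pose proof (H1 i ltac:(lia)); pose proof (H2 i ltac:(lia)). nra.
Qed.

Theorem theorem6 (n m k : nat) (b : R) (Sc : nat -> list nat)
  (thstar : nat -> R) (lam2 : R) :
  (2 <= k)%nat ->
  (0 < m)%nat ->
  (forall t, (t < m)%nat ->
     NoDup (Sc t) /\ length (Sc t) = k /\ (forall i, In i (Sc t) -> (i < n)%nat)) ->
  in_Theta n b thstar ->
  is_lambda2 n (laplacian n (Mmat n m Sc)) lam2 ->
  lam2 >= 8 * INR k * INR (k - 1) * exp (2 * b) * INR n * ln (INR n) / INR m ->
  prob m k Sc thstar
    (fun o => forall th, is_argmax n b (ell1 m o) th ->
       mse n th thstar <=
         (4 * INR k * INR (k - 1) * exp (2 * b)) ^ 2
         * (INR n * (ln (INR n) + 2) / lam2 ^ 2) * / INR m)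
  >= 1 - 3 / INR n.
Proof.
  intros Hk Hm HS HT Hl Hlam. apply Rle_ge.
  destruct n as [|d].
  { exfalso. destruct (HS 0%nat Hm) as [_ [Hlen Hin]].
    destruct (Sc 0%nat) as [|i l]; [simpl in Hlen; lia|].
    pose proof (Hin i (or_introl eq_refl)). lia. }
  assert (Hn : 1 <= INR (S d)) by (rewrite S_INR; pose proof (pos_INR d); lra).
  destruct (PeanoNat.Nat.le_gt_cases 3 d) as [Hd|Hd].
  (* For [n <= 3] the claimed probability is at most zero. *)
  2:{ eapply Rle_trans; [|apply (Concentration.luce_prob_ge0 (d := d) thstar (ssrbool.introT ssrnat.leP Hk) HS)].
      assert (INR (S d) <= 3) by (apply (le_INR _ 3) in Hd; simpl in *; lra).
      apply Rmult_le_reg_r with (INR (S d)); [lra|].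
      replace ((1 - 3 / INR (S d)) * INR (S d)) with (INR (S d) - 3) by (field; lra). lra. }
  assert (Hn4 : 4 <= INR (S d)) by (apply (le_INR 3) in Hd; rewrite S_INR; simpl in Hd; lra).
  set (N := INR (S d)) in *.
  assert (HL : 0 < ln N) by (rewrite <- ln_1; apply ln_increasing; lra).
  assert (HM : 0 < INR m) by (apply lt_0_INR; lia).
  assert (HK : 0 < INR k) by (apply lt_0_INR; lia).
  assert (HK1 : 0 < INR (k - 1)) by (apply lt_0_INR; lia).
  pose proof (exp_pos (2 * b)) as HE.
  assert (Hlam0 : 0 < lam2).
  { eapply Rlt_le_trans; [|apply Rge_le; exact Hlam].
    apply Rdiv_lt_0_compat; [|exact HM]. repeat apply Rmult_lt_0_compat; lra. }
  assert (Hb : 0 <= b). { destruct HT as [HT _]. pose proof (HT 0%nat ltac:(lia)). lra. }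
  set (Bd := (4 * INR k * INR (k - 1) * exp (2 * b)) ^ 2 * (N * (ln N + 2) / lam2 ^ 2) * / INR m).
  assert (HBd : 0 < Bd).
  { unfold Bd. apply Rmult_lt_0_compat; [|apply Rinv_0_lt_compat; exact HM].
    apply Rmult_lt_0_compat.
    - apply pow_lt. repeat apply Rmult_lt_0_compat; lra.
    - apply Rdiv_lt_0_compat; [nra|apply pow_lt; exact Hlam0]. }
  (* A bound of at least [4 * b ^ 2] holds for any two points of the box. In the other case the
     inequality acts as a lower bound on [m], and it excludes [b = 0] since [Bd] is positive. *)
  destruct (Rle_or_lt (4 * b ^ 2) Bd) as [Htriv|Hnt].
  { eapply Rle_trans; [|right; symmetry; apply (Concentration.luce_prob_true (d := d) thstar
      (ssrbool.introT ssrnat.leP Hk) HS)].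
    - assert (0 < 3 / N) by (apply Rdiv_lt_0_compat; lra). change (1 - 3 / N <= 1). lra.
    - intros o th [Hth _]. eapply Rle_trans; [|exact Htriv].
      apply mse_le_box; [lia|exact Hth|exact HT]. }
  assert (Hb0 : 0 < b) by (destruct Hb as [Hb|Hb]; [exact Hb | subst b; nra]).
  assert (E : exp (- (2 * b)) = / exp (2 * b)) by apply exp_Ropp.
  apply Concentration.luce_mle_probR with (lam := lam2); try assumption.
  (* After clearing denominators this is [Bd < 4 * b ^ 2] in weak form. *)
  - rewrite E. fold N. set (e := exp (2 * b)) in *.
    unfold Bd in Hnt. set (c := INR k * INR (k - 1)).
    assert (Hc : 0 < c) by (unfold c; nra).
    apply (Rmult_lt_compat_r (lam2 ^ 2 * INR m)) in Hnt;
      [|apply Rmult_lt_0_compat; [apply pow_lt; exact Hlam0 | exact HM]].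
    replace ((4 * INR k * INR (k - 1) * e) ^ 2 * (N * (ln N + 2) / lam2 ^ 2) * / INR m * (lam2 ^ 2 * INR m))
      with (16 * c ^ 2 * e ^ 2 * N * (ln N + 2)) in Hnt by (unfold c; field; repeat split; lra).
    apply Rmult_le_reg_r with (8 * c ^ 2 * e * N).
    { repeat apply Rmult_lt_0_compat; try lra. }
    replace (lam2 / c * b ^ 2 * (/ e * INR m * (lam2 / c) / (2 * N)) * (8 * c ^ 2 * e * N))
      with (4 * b ^ 2 * (lam2 ^ 2 * INR m)) by (field; repeat split; lra).
    replace (2 * e * (ln N + 2) * (8 * c ^ 2 * e * N)) with (16 * c ^ 2 * e ^ 2 * N * (ln N + 2)) by ring.
    lra.
  - fold N. right. unfold Bd. field. repeat split; lra.
Qed.
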